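(* Let $(\mathcal{A},\varphi)$ be a $W^*$-probability space and let $\mathbb{U},\mathbb{V}$ be (self-adjoint) non-commutative random variables in $(\mathcal{A},\varphi)$ which are freely independent, such that $\mathbb{V}$ has a distribution compactly supported in $(0,\infty)$ and the distribution of $\mathbb{U}$ is supported in $[0,1]$. Assume that there exist real constants $c_1$ and $c_2$ such that $$\varphi\left(\left.\mathbb{V}-\mathbb{V}^{1/2}\mathbb{U}\mathbb{V}^{1/2}\,\right|\,\mathbb{V}^{1/2}\mathbb{U}\mathbb{V}^{1/2}\right)=c_1\,\mathbb{I}$$ and $$\varphi\left(\left.\left(\mathbb{V}-\mathbb{V}^{1/2}\mathbb{U}\mathbb{V}^{1/2}\right)^2\,\right|\,\mathbb{V}^{1/2}\mathbb{U}\mathbb{V}^{1/2}\right)=c_2\,\mathbb{I}.$$ Then $\mathbb{V}$ has the free-Poisson distribution $\nu(\lambda,\alpha)$ with $\lambda=\sigma+\theta$, where $\sigma>0$ and $\theta=\frac{c_1^2}{c_2-c_1^2}>0$, and with $\alpha=\frac{c_2-c_1^2}{c_1}>0$, and $\mathbb{U}$ has the free-binomial distribution $\beta(\sigma,\theta)$.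
   Context: A $W^*$-probability space $(\mathcal{A},\varphi)$ is a von Neumann algebra $\mathcal{A}\subset\mathcal{B}(H)$ (bounded operators on a Hilbert space $H$) with a faithful, normal, tracial state $\varphi$ ($\varphi(\mathbb{X}\mathbb{Y})=\varphi(\mathbb{Y}\mathbb{X})$); $\mathbb{I}$ is the identity. The distribution of a self-adjoint $\mathbb{X}\in\mathcal{A}$ is the probability measure $\mu$ on $\mathbb{R}$ with $\varphi(\mathbb{X}^r)=\int t^r\,\mu(dt)$ for all $r\ge 1$. Random variables $\mathbb{X},\mathbb{Y}$ are freely independent if the subalgebras generated by $(\mathbb{X},\mathbb{I})$ and $(\mathbb{Y},\mathbb{I})$ are free, i.e. $\varphi$ vanishes on every product of elements with $\varphi$-value $0$ in which neighbouring factors come from different subalgebras. For a von Neumann subalgebra $\mathcal{B}\subset\mathcal{A}$, the conditional expectation $\varphi(\cdot|\mathcal{B})$ is the faithful normal projection of $\mathcal{A}$ onto $\mathcal{B}$ with $\varphi(\varphi(\cdot|\mathcal{B}))=\varphi$; it satisfies $\varphi(\mathbb{X}\mathbb{Y})=\varphi(\varphi(\mathbb{X}|\mathcal{B})\mathbb{Y})$ for $\mathbb{X}\in\mathcal{A}$, $\mathbb{Y}\in\mathcal{B}$. For a random variable $\mathbb{Z}$, $\varphi(\cdot|\mathbb{Z})$ is the conditional expectation given the von Neumann subalgebra generated by $\mathbb{Z}$ and $\mathbb{I}$. Free-Poisson distribution $\nu(\lambda,\alpha)$, with rate $\lambda\ge 0$ and jump size $\alpha>0$: $\nu(\lambda,\alpha)=\max\{0,1-\lambda\}\,\delta_0+\tilde\nu$,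 where $\tilde\nu$ is supported on $(\alpha(1-\sqrt\lambda)^2,\alpha(1+\sqrt\lambda)^2)$ with density $\tilde\nu(dx)=\frac{1}{2\pi\alpha x}\sqrt{4\lambda\alpha^2-(x-\alpha(1+\lambda))^2}\,dx$ (equivalently, its $n$-th free cumulant is $\lambda\alpha^n$ for all $n\ge1$). Free-binomial distribution $\beta(\sigma,\theta)$: $\beta(\sigma,\theta)=(1-\sigma)\mathbf{1}_{\{0<\sigma<1\}}\delta_0+\tilde\beta+(1-\theta)\mathbf{1}_{\{0<\theta<1\}}\delta_1$, where $\tilde\beta$ is supported on $(x_-,x_+)$, $x_{\pm}=\left(\sqrt{\frac{\sigma}{\sigma+\theta}\left(1-\frac{1}{\sigma+\theta}\right)}\pm\sqrt{\frac{1}{\sigma+\theta}\left(1-\frac{\sigma}{\sigma+\theta}\right)}\right)^2$, with density $\tilde\beta(dx)=(\sigma+\theta)\frac{\sqrt{(x-x_-)(x_+-x)}}{2\pi x(1-x)}\,dx$. It is a probability distribution exactly when $\frac{\sigma+\theta}{\sigma+\theta-1}>0$ and $\frac{\sigma\theta}{\sigma+\theta-1}>0$; only such parameters with $\sigma,\theta>0$ (that is, $\sigma,\theta>0$ and $\sigma+\theta>1$) are considered here.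
   Formalization: The formal theorem additionally assumes that U is not a scalar multiple of the identity; without this the claim fails (e.g. U = 0 with V arbitrary satisfies both conditions), and for scalar U the conclusion never holds. *)

(* Defs.v *)
From HB Require Import structures.
From mathcomp Require Import all_boot all_order all_algebra.
From mathcomp Require Import all_classical all_reals all_analysis.
From mathcomp Require Import complex.

Set Implicit Arguments.
Unset Strict Implicit.
Unset Printing Implicit Defensive.

Import Order.TTheory GRing.Theory Num.Theory.
Import numFieldNormedType.Exports.

Local Open Scope classical_set_scope.
Local Open Scope ring_scope.
Local Open Scope complex_scope.

(* hdot is linear in its first argument and conjugate-linear in its second. *)
HB.mixin Record CompleteNormedModule_isHilbert (R : realType) H
    of CompleteNormedModule R[i] H := {
  hdot : {dot H for @Num.conj R[i]} ;
  hdotxx : forall x : H, hdot x x = `|x| ^+ 2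
}.

#[short(type="hilbertType")]
HB.structure Definition Hilbert (R : realType) :=
  {H of CompleteNormedModule R[i] H & CompleteNormedModule_isHilbert R H}.

Section BoundedOperator.
Context {R : realType} (H : hilbertType R).

Definition bounded_linear : {pred H -> H} :=
  mem [set f : H -> H | linear f /\
    exists M : R[i], forall x, `|f x| <= M * `|x|].

Record bounded_operator := BoundedOperator {
  bop_val :> H -> H ; bop_valP : bop_val \in bounded_linear }.

HB.instance Definition _ := [isSub for bop_val].
HB.instance Definition _ := gen_eqMixin bounded_operator.
HB.instance Definition _ := gen_choiceMixin bounded_operator.

Lemma bounded_linearP (f : H -> H) :
  reflect (linear f /\ exists2 M : R[i], 0 <= M & forall x, `|f x| <= M * `|x|)
    (f \in bounded_linear).
Proof.
apply: (iffP idP); last by case=> lf [M _ fM]; rewrite inE; split => //; exists M.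
rewrite inE => -[lf [M fM]]; split=> //; exists `|M|; first exact: normr_ge0.
have [x0|x0] := pselect (exists x : H, x != 0); last first.
  move=> x; have -> : x = 0.
    by apply/eqP; apply: contra_notT x0 => xneq0; exists x.
  have f0 : f 0 = 0 by have := lf (-1) 0 0; rewrite scaler0 addr0 scaleN1r addNr.
  by rewrite f0 !normr0 mulr0.
case: x0 => y y0; have M0 : 0 <= M.
  have := le_trans (normr_ge0 _) (fM y).
  by rewrite pmulr_lge0 // normr_gt0.
by rewrite ger0_norm.
Qed.

Lemma bounded_linear_submod : GRing.submod_closed bounded_linear.
Proof.
split=> [|a f g /bounded_linearP[lf [M M0 fM]] /bounded_linearP[lg [N N0 gN]]].
  apply/bounded_linearP; split=> [a x y|]; first by rewrite /= scaler0 addr0.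
  by exists 0 => // x; rewrite normr0 mul0r.
apply/bounded_linearP; split.
  move=> b x y; rewrite !fctE lf lg !scalerDr !scalerA [a * b]mulrC.
  by rewrite addrACA.
exists (`|a| * M + N) => [|x]; first by rewrite addr_ge0 ?mulr_ge0.
rewrite !fctE (le_trans (ler_normD _ _))// mulrDl lerD//.
by rewrite normrZ -mulrA ler_wpM2l.
Qed.
HB.instance Definition _ :=
  GRing.isSubmodClosed.Build _ _ bounded_linear bounded_linear_submod.
HB.instance Definition _ := [SubChoice_isSubLmodule of bounded_operator by <:].

Lemma bounded_linear_id : idfun \in bounded_linear.
Proof.
by apply/bounded_linearP; split=> //; exists 1 => // x; rewrite mul1r.
Qed.

Lemma bounded_linear_comp (S T : bounded_operator) :
  S \o T \in bounded_linear.
Proof.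
have /bounded_linearP[lS [M M0 SM]] := bop_valP S.
have /bounded_linearP[lT [N N0 TN]] := bop_valP T.
apply/bounded_linearP; split; first by move=> a x y /=; rewrite lT lS.
exists (M * N) => [|x /=]; first exact: mulr_ge0.
by rewrite (le_trans (SM _))// -mulrA ler_wpM2l.
Qed.

(* Multiplication is composition: (S * T) x = S (T x). *)
Definition bop_one := BoundedOperator bounded_linear_id.
Definition bop_mul (S T : bounded_operator) :=
  BoundedOperator (bounded_linear_comp S T).

Fact bop_mulA : associative bop_mul.
Proof. by move=> S T U; apply: val_inj. Qed.
Fact bop_mul1 : left_id bop_one bop_mul.
Proof. by move=> S; apply: val_inj. Qed.
Fact bop_1mul : right_id bop_one bop_mul.
Proof. by move=> S; apply: val_inj. Qed.
Fact bop_mulDl : left_distributive bop_mul +%R.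
Proof. by move=> S T U; apply: val_inj. Qed.
Fact bop_mulDr : right_distributive bop_mul +%R.
Proof.
move=> S T U; apply: val_inj; apply/funext => x /=.
have /bounded_linearP[lS _] := bop_valP S.
by have := lS 1 (T x) (U x); rewrite !scale1r.
Qed.

(* Only a pzRing: 1 <> 0 would require H to be nonzero. *)
HB.instance Definition _ := GRing.Zmodule_isPzRing.Build bounded_operator
  bop_mulA bop_mul1 bop_1mul bop_mulDl bop_mulDr.

End BoundedOperator.

Notation "''B(' H )" := (bounded_operator H) (format "''B(' H )") : type_scope.

Section Wstar.
Context {R : realType} {H : hilbertType R}.
Implicit Types (A B : set 'B(H)) (S T X Y Z : 'B(H)).
Implicit Types (phi : 'B(H) -> R[i]) (E : 'B(H) -> 'B(H)).

Definition adjoint_pair S T := forall x y : H, hdot (S x) y = hdot x (T y).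
Definition self_adjoint T := adjoint_pair T T.
Definition positive_op T := forall x : H, 0 <= hdot (T x) x.
Definition loewner S T := positive_op (T - S).

Definition unital_subalgebra A :=
  [/\ A 1,
      forall S T, A S -> A T -> A (S + T),
      forall (a : R[i]) T, A T -> A (a *: T) &
      forall S T, A S -> A T -> A (S * T)].

Definition weakly_closed A := forall T,
  (forall (s : seq H) (e : R), 0 < e -> exists2 X, A X &
    forall x y, x \in s -> y \in s -> `|hdot (T x - X x) y| < e%:C) ->
  A T.

Definition von_neumann_algebra A :=
  [/\ unital_subalgebra A,
      forall S, A S -> exists2 T, adjoint_pair S T & A T &
      weakly_closed A].

Definition generated_algebra X : set 'B(H) :=
  [set T | forall B, unital_subalgebra B -> B X -> B T].

Definition generated_vna X : set 'B(H) :=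
  [set T | forall B, von_neumann_algebra B -> B X -> B T].

Definition least_upper_bound (T : Type) (le : T -> T -> Prop) (P D : set T)
    (x : T) :=
  [/\ P x, forall y, D y -> le y x &
      forall z, P z -> (forall y, D y -> le y z) -> le x z].

Definition sa_part A : set 'B(H) := [set T | A T /\ self_adjoint T].

(* f preserves suprema of bounded increasing nets in A; D is the range of the
   net, and P the part of the codomain in which the supremum is taken. *)
Definition normal_map (T : Type) A (le : T -> T -> Prop) (P : set T)
    (f : 'B(H) -> T) :=
  forall (D : set 'B(H)) X, D !=set0 -> D `<=` sa_part A ->
    (forall S T, D S -> D T -> exists U, [/\ D U, loewner S U & loewner T U]) ->
    least_upper_bound loewner (sa_part A) D X ->
    least_upper_bound le P (f @` D) (f X).

(* phi and E are functions on all of B(H); only their values on A matter. *)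
Record wstar_probability_space A phi : Prop := WstarProbabilitySpace {
  wstar_vna : von_neumann_algebra A ;
  wstar_add : forall S T, A S -> A T -> phi (S + T) = phi S + phi T ;
  wstar_scale : forall a T, A T -> phi (a *: T) = a * phi T ;
  wstar_one : phi 1 = 1 ;
  wstar_ge0 : forall T, A T -> positive_op T -> 0 <= phi T ;
  wstar_faithful : forall T, A T -> positive_op T -> phi T = 0 -> T = 0 ;
  wstar_normal : normal_map A (fun a b : R[i] => a <= b) setT phi ;
  wstar_tracial : forall S T, A S -> A T -> phi (S * T) = phi (T * S)
}.

(* cexp_pairing, with cexp_range and the faithfulness of phi, determines E
   on A: there is at most one conditional expectation up to its values off A. *)
Record conditional_expectation A phi B E : Prop := ConditionalExpectation {
  cexp_range : forall X, A X -> B (E X) ;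
  cexp_id : forall Y, B Y -> E Y = Y ;
  cexp_add : forall S T, A S -> A T -> E (S + T) = E S + E T ;
  cexp_scale : forall (a : R[i]) T, A T -> E (a *: T) = a *: E T ;
  cexp_ge0 : forall T, A T -> positive_op T -> positive_op (E T) ;
  cexp_faithful : forall T, A T -> positive_op T -> E T = 0 -> T = 0 ;
  cexp_normal : normal_map A loewner (sa_part B) E ;
  cexp_phi : forall X, A X -> phi (E X) = phi X ;
  cexp_pairing : forall X Y, A X -> B Y -> phi (X * Y) = phi (E X * Y)
}.

Definition cond_exp_given A phi Z E :=
  conditional_expectation A phi (generated_vna Z) E.

Definition positive_sqrt A X S := [/\ A S, positive_op S & S * S = X].

Definition free_subalgebras phi (B : bool -> set 'B(H)) :=
  forall (n : nat) (i : nat -> bool) (X : nat -> 'B(H)),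
    (forall k, (k <= n)%N -> B (i k) (X k) /\ phi (X k) = 0) ->
    (forall k, (k < n)%N -> i k != i k.+1) ->
    phi (\prod_(k < n.+1) X k) = 0.

Definition freely_independent phi X Y :=
  free_subalgebras phi
    (fun b => if b then generated_algebra X else generated_algebra Y).

(* The moments of a bounded self-adjoint X grow at most geometrically, so they
   determine mu among all probability measures on R. *)
Definition has_distribution phi X (mu : probability (measurableTypeR R) R) :=
  forall r : nat, (1 <= r)%N ->
    mu.-integrable setT (fun t : R => (t ^+ r)%:E) /\
    phi (X ^+ r) = (\int[mu]_t (t ^+ r))%:C.

Definition distribution_supported_in phi X (K : set R) :=
  exists2 mu, has_distribution phi X mu & mu K = 1%:E.

Definition has_law phi X (F : set R -> \bar R) :=
  exists2 mu, has_distribution phi X mu &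
    forall D : set (measurableTypeR R), measurable D -> mu D = F D.

End Wstar.

Section FreeLaws.
Context {R : realType}.
Implicit Types (lambda alpha sigma theta x : R) (D : set R).

Definition free_poisson_pdf lambda alpha x : R :=
  (2 * pi * alpha * x)^-1 *
  Num.sqrt (4 * lambda * alpha ^+ 2 - (x - alpha * (1 + lambda)) ^+ 2).

Definition free_poisson_interval lambda alpha : set R :=
  `]alpha * (1 - Num.sqrt lambda) ^+ 2, alpha * (1 + Num.sqrt lambda) ^+ 2[.

(* The laws are set functions that are not assumed to be measures; has_law
   requires them to agree with a probability measure. *)
Definition free_poisson lambda alpha D : \bar R :=
  ((Num.max 0 (1 - lambda))%R%:E * dirac (0%R : R) D +
   \int[lebesgue_measure]_(x in D `&` free_poisson_interval lambda alpha)
     (free_poisson_pdf lambda alpha x)%:E)%E.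

Definition fbinom_left sigma theta : R :=
  (Num.sqrt (sigma / (sigma + theta) * (1 - (sigma + theta)^-1)) -
   Num.sqrt ((sigma + theta)^-1 * (1 - sigma / (sigma + theta)))) ^+ 2.

Definition fbinom_right sigma theta : R :=
  (Num.sqrt (sigma / (sigma + theta) * (1 - (sigma + theta)^-1)) +
   Num.sqrt ((sigma + theta)^-1 * (1 - sigma / (sigma + theta)))) ^+ 2.

Definition free_binomial_pdf sigma theta x : R :=
  (sigma + theta) *
  (Num.sqrt ((x - fbinom_left sigma theta) * (fbinom_right sigma theta - x)) /
   (2 * pi * x * (1 - x))).

Definition free_binomial_interval sigma theta : set R :=
  `]fbinom_left sigma theta, fbinom_right sigma theta[.

Definition atom_weight (s : R) : R := if 0 < s < 1 then 1 - s else 0.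

Definition free_binomial sigma theta D : \bar R :=
  ((atom_weight sigma)%:E * dirac (0%R : R) D +
   \int[lebesgue_measure]_(x in D `&` free_binomial_interval sigma theta)
     (free_binomial_pdf sigma theta x)%:E +
   (atom_weight theta)%:E * dirac (1%R : R) D)%E.

End FreeLaws.

(* Main.v *)
Require Import Defs.
From HB Require Import structures.
From mathcomp Require Import all_boot all_order all_algebra.
From mathcomp Require Import all_classical all_reals all_analysis.
From mathcomp Require Import measurable_realfun.
From mathcomp Require Import complex.
From mathcomp Require Import ring lra.

Set Implicit Arguments.
Unset Strict Implicit.
Unset Printing Implicit Defensive.

Import Order.TTheory GRing.Theory Num.Theory.
Import numFieldNormedType.Exports.

Local Open Scope classical_set_scope.
Local Open Scope ring_scope.
Local Open Scope complex_scope.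

(* Cutting an alternating word of two free algebras in all possible places, with
   alternating signs, gives an identity between products of moments. For
   G_j = sum_n phi ((U V)^n V^j) z^n and H_j = sum_n phi ((V U)^n U^j) z^n it reads
   G_0 (G_j - phi (V^j)) = z H_1 G_(j+1), so that G_j = phi (V^j) + w G_(j+1) with
   w = z H_1 / G_0: w is the subordination series of V, and eta = z G_1 / G_0 is
   that of U. The two regression conditions are linear relations between z, G_0,
   G_1 and G_2. Eliminating z, they become a quadratic equation between w (or eta)
   and psi = G_0 - 1, and since w and eta have order one this is an equation for
   the moment series of V (or U) itself. Solving it produces the square root of
   (1 - a z) (1 - b z), whose coefficients are, up to the factor - 1 / pi, the moments of
   the semicircle sqrt ((x - a) (b - x)); these are also the moments of the claimed
   densities. The rate of V exceeds 1 because otherwise the free Poisson law would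
   charge every neighbourhood of 0. *)

(** * Cuts of alternating words *)

(** A law is known here only through its moments, so the subordination argument stays within formal
    power series and needs no analytic continuation. Composition is avoided too: iterating G_j = phi
    (V^j) + w G_(j+1) gives G_0 = sum_(k < N) phi (V^k) w^k + w^N G_N for every N, and this is the
    sense in which G_0 is the moment series of V evaluated at w. The operator V^(1/2) U V^(1/2)
    enters only through its moments, which by traciality are the coefficients of G_0. The
    elimination also gives G_0 the free Poisson equation with jump alpha and mean phi (V) - c_1.
    This is the origin of sigma = (phi (V) - c_1) / alpha; similarly alpha theta = c_1. Forming
    these quotients requires c_1 and c_2 - c_1^2 to be positive, which rests on U not being a
    scalar. The claimed laws are mere set functions, so probability measures realising them must be
    built. Their total mass needs integrals of the semicircle against 1 / x and 1 / (1 - x), also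
    when 0 or 1 is an endpoint of the support. *)

Section AlternatingWords.
Context {R : realType} {H : hilbertType R}.
Context (A : set 'B(H)) (phi : 'B(H) -> R[i]).
Hypothesis A_alg : unital_subalgebra A.
Hypothesis phiD : forall S T, A S -> A T -> phi (S + T) = phi S + phi T.
Hypothesis phiZ : forall a T, A T -> phi (a *: T) = a * phi T.
Hypothesis phi1 : phi 1 = 1.
Context (B : bool -> set 'B(H)).
Hypothesis B_alg : forall b, unital_subalgebra (B b).
Hypothesis B_sub : forall b, B b `<=` A.
Hypothesis B_free : free_subalgebras phi B.

Implicit Types (x y z acc : 'B(H)) (s t p : seq 'B(H)) (b : bool).

Lemma bop_scaleAl (a : R[i]) x y : a *: (x * y) = (a *: x) * y.
Proof. by apply: val_inj. Qed.

Lemma bop_scaleAr (a : R[i]) x y : a *: (x * y) = x * (a *: y).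
Proof.
apply: val_inj; apply/funext => v /=.
have /bounded_linearP[lx _] := bop_valP x.
have x0 : x 0 = 0 by have := lx (-1) 0 0; rewrite scaler0 addr0 scaleN1r addNr.
by have := lx a (y v) 0; rewrite x0 !addr0.
Qed.

Fixpoint word_prod s : 'B(H) := if s is y :: s' then y * word_prod s' else 1.

(* [cut_sum 1 s] is the sum over k of [(-1)^k phi (prefix_k s) phi (suffix_k s)],
   where [prefix_k s] and [suffix_k s] are cut off [s] at position [k]. *)
Fixpoint cut_sum acc s : R[i] :=
  phi acc * phi (word_prod s) - (if s is y :: s' then cut_sum (acc * y) s' else 0).

Fixpoint alternating_word b s : Prop :=
  if s is y :: s' then B b y /\ alternating_word (~~ b) s' else True.

Lemma cut_sumE acc s : cut_sum acc s = phi acc * phi (word_prod s) -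
  (if s is y :: s' then cut_sum (acc * y) s' else 0).
Proof. by case: s. Qed.

Lemma word_prod_cat s t : word_prod (s ++ t) = word_prod s * word_prod t.
Proof. by elim: s => [|y s IH] /=; rewrite ?mul1r // IH mulrA. Qed.

Lemma alternating_cat b s t :
  alternating_word b (s ++ t) <-> alternating_word b s /\ alternating_word (b (+) odd (size s)) t.
Proof.
elim: s b => [|y s IH] b /=; first by rewrite addbF; tauto.
by rewrite IH addbN addNb; tauto.
Qed.

Let in_A s := forall y, y \in s -> A y.

Lemma alternating_A b s : alternating_word b s -> in_A s.
Proof.
elim: s b => [|y s IH] b /= => [_ y|[By /IH As] z]; first by rewrite in_nil.
by rewrite inE => /orP[/eqP->|/As//]; exact: B_sub By.
Qed.

Lemma in_A_prod s : in_A s -> A (word_prod s).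
Proof.
have [A1 _ _ AM] := A_alg.
elim: s => [_|y s IH As] //=; apply: AM; first by apply: As; rewrite mem_head.
by apply: IH => z zs; apply: As; rewrite inE zs orbT.
Qed.

Lemma in_A_cons y s : in_A (y :: s) <-> A y /\ in_A s.
Proof.
split=> [As|[Ay As] z]; last by rewrite inE => /orP[/eqP->|/As].
split; first by apply: As; rewrite mem_head.
by move=> z zs; apply: As; rewrite inE zs orbT.
Qed.

Lemma in_A_cat s t : in_A (s ++ t) <-> in_A s /\ in_A t.
Proof.
elim: s => [|y s IH] /=; first by split=> [|[]] //; split.
by rewrite !in_A_cons IH; tauto.
Qed.

Lemma cut_sum_linear_acc (c : R[i]) x y s : A x -> A y -> in_A s ->
  cut_sum (x + c *: y) s = cut_sum x s + c * cut_sum y s.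
Proof.
have [A1 AD AZ AM] := A_alg.
elim: s x y => [|w s IH] x y Ax Ay As /=; rewrite phiD ?phiZ //; try exact: AZ.
  by rewrite !subr0 mulrDl mulrA.
move/in_A_cons: As => [Aw As].
rewrite [(x + _) * w]mulrDl -bop_scaleAl IH; [ring|exact: AM|exact: AM|exact: As].
Qed.

Lemma word_prod_linear (c : R[i]) x y p t :
  word_prod (p ++ (x + c *: y) :: t) =
  word_prod (p ++ x :: t) + c *: word_prod (p ++ y :: t).
Proof.
rewrite !word_prod_cat /=; rewrite mulrDl mulrDr; congr (_ + _).
by rewrite -bop_scaleAl -bop_scaleAr.
Qed.

Lemma cut_sum_linear (c : R[i]) acc x y p t :
  A acc -> in_A p -> A x -> A y -> in_A t ->
  cut_sum acc (p ++ (x + c *: y) :: t) =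
  cut_sum acc (p ++ x :: t) + c * cut_sum acc (p ++ y :: t).
Proof.
have [A1 AD AZ AM] := A_alg.
move=> Aacc Ap Ax Ay At; elim: p acc Aacc Ap => [|w p IH] acc Aacc Ap.
  have AMt w : A w -> A (w * word_prod t) by move=> Aw; apply: AM => //; exact: in_A_prod.
  rewrite /= [(x + _) * _]mulrDl -bop_scaleAl phiD ?phiZ; [|exact: AMt|exact: AMt|exact/AZ/AMt].
  rewrite [acc * (x + _)]mulrDr -bop_scaleAr cut_sum_linear_acc; [ring|exact: AM|exact: AM|exact: At].
move/in_A_cons: Ap => [Aw Ap].
rewrite /= IH //; last exact: AM.
rewrite word_prod_linear mulrDr -bop_scaleAr phiD ?phiZ; first ring.
all: try apply: AZ; apply: AM => //; apply: in_A_prod; apply/in_A_cat; split => //; exact/in_A_cons.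
Qed.

Lemma cut_sum_merge acc x z p t :
  cut_sum acc (p ++ [:: x, 1, z & t]) = cut_sum acc (p ++ (x * z) :: t).
Proof.
elim: p acc => [|w p IH] acc /=; last by rewrite IH !word_prod_cat /= !mul1r !mulrA.
rewrite !mulr1 !mul1r !mulrA; ring.
Qed.

(** The two cuts around the final 1 cancel each other, so the cut at the end of [s], present in
    [cut_sum acc s], has to be taken away. *)
Lemma cut_sum_rcons1 acc s : cut_sum acc (s ++ [:: 1]) =
  cut_sum acc s - (-1) ^+ size s * phi (acc * word_prod s).
Proof.
elim: s acc => [|w s IH] acc /=.
  by rewrite !mulr1 phi1 !mulr1 subr0 subrr expr0 mul1r subrr.
by rewrite IH !word_prod_cat /= !mulr1 mulrA exprS; ring.
Qed.

Let centred s := forall y, y \in s -> phi y = 0.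

Lemma alternating_nth b s k : alternating_word b s -> (k < size s)%N ->
  B (b (+) odd k) (nth 1 s k).
Proof.
elim: s b k => // y s IH b [|k] /= [By sP] ks; first by rewrite addbF.
by rewrite addbN -addNb; apply: IH.
Qed.

Lemma word_prodE s : word_prod s = \prod_(k < size s) nth 1 s k.
Proof.
elim: s => [|y s IH] /=; first by rewrite big_ord0.
by rewrite big_ord_recl IH.
Qed.

Lemma phi_centred b s : alternating_word b s -> centred s -> s != [::] ->
  phi (word_prod s) = 0.
Proof.
case: s => // y s sP sc _.
rewrite word_prodE /=.
apply: (@B_free (size s) (fun k => b (+) odd k) (fun k => nth 1 (y :: s) k)).
  move=> k ks; split; first exact: alternating_nth.
  by apply: sc; apply: mem_nth.
by move=> k _ /=; rewrite addbN; case: (_ (+) _).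
Qed.

Lemma cut_sum_centred b s : alternating_word b s -> centred s -> s != [::] ->
  cut_sum 1 s = 0.
Proof.
(* With a nonempty prefix [q] in the accumulator, every cut has the factor phi of a nonempty centred
   alternating word. Only the cut before the first letter has to be treated apart. *)
suff key q t : alternating_word b (q ++ t) -> centred (q ++ t) -> q != [::] ->
    cut_sum (word_prod q) t = 0.
  case: s => // y s sP sc _; rewrite /= phi1 !mul1r (@phi_centred b (y :: s)) // sub0r.
  by rewrite -[y]mulr1 (key [:: y]) ?oppr0.
elim: t q => [|y t IH] q qtP qtc q0.
  by rewrite cats0 in qtP qtc; rewrite /= (phi_centred qtP qtc q0) // mul0r subr0.
rewrite cut_sumE (@phi_centred b q) //.
- rewrite mul0r sub0r.
  have -> : word_prod q * y = word_prod (q ++ [:: y]) by rewrite word_prod_cat /= mulr1.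
  by rewrite IH ?oppr0 -?catA //; case: (q) q0.
- by have /alternating_cat[] := qtP.
- by move=> z zq; apply: qtc; rewrite mem_cat zq.
Qed.

(* Both sides are multilinear in the letters, so each letter may be taken
   centred or equal to 1. On centred words both sides vanish; a letter 1 inside
   the word merges its neighbours, and the two cuts around it cancel. *)
Lemma cut_sum_alternating b s : alternating_word b s ->
  cut_sum 1 s = if odd (size s) then 0 else phi (word_prod s).
Proof.
have [A1 AD AZ AM] := A_alg.
have [n] := ubnP (size s); elim: n b s => // n IHn b s.
rewrite ltnS => sn sP.
(* [p] holds the letters already centred, and the inner induction centres those of [t] one at a
   time. The letters 1 split off on the way are left to the outer induction on the length. *)
suff key t p : (size (p ++ t) <= n)%N -> alternating_word b (p ++ t) -> centred p ->
    cut_sum 1 (p ++ t) = if odd (size (p ++ t)) then 0 else phi (word_prod (p ++ t)).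
  by apply: (key s [::]).
elim: t p => [|y t IHt] p ptn ptP pc.
  rewrite cats0 in ptn ptP *; case: p ptn ptP pc => [|z p] ptn ptP pc.
    by rewrite /= phi1 mul1r subr0.
  by rewrite (@cut_sum_centred b) // (@phi_centred b) // if_same.
have /alternating_cat[pP /= [By tP]] := ptP.
set y0 := y + (- phi y) *: (1 : 'B(H)).
have [B1 BD BZ BM] := B_alg (b (+) odd (size p)).
have Ap := alternating_A pP; have At := alternating_A tP.
have Ay := B_sub By.
have Ay0 : A y0 by apply: AD => //; exact: AZ.
have yE : y = y0 + phi y *: (1 : 'B(H)) by rewrite /y0 scaleNr -addrA addNr addr0.
have ptE x : size (p ++ x :: t) = (size p + size t).+1 by rewrite size_cat /= addnS.
rewrite yE cut_sum_linear // word_prod_linear.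
have Awp x : A x -> A (word_prod (p ++ x :: t)).
  by move=> Ax; apply: in_A_prod; apply/in_A_cat; split => //; exact/in_A_cons.
rewrite phiD ?phiZ; [|exact: Awp|exact: Awp|exact/AZ/Awp].
have -> : cut_sum 1 (p ++ y0 :: t) = if odd (size (p ++ y0 :: t)) then 0 else
    phi (word_prod (p ++ y0 :: t)).
  rewrite -cat_rcons; apply: IHt.
  - by rewrite cat_rcons ptE -(ptE y).
  - rewrite cat_rcons; apply/alternating_cat; split => //=; split => //.
    by apply: BD => //; apply: BZ.
  - move=> z; rewrite mem_rcons inE => /orP[/eqP->|/pc//].
    by rewrite /y0 phiD ?phiZ ?phi1; [ring|exact: A1|exact: Ay|exact: AZ].
suff -> : cut_sum 1 (p ++ 1 :: t) = if odd (size (p ++ 1 :: t)) then 0 else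
    phi (word_prod (p ++ 1 :: t)).
  by rewrite !ptE; case: ifP => _; rewrite ?mulr0 ?addr0.
rewrite ptE /=.
have wE : word_prod (p ++ 1 :: t) = word_prod (p ++ t).
  by rewrite !word_prod_cat /= mul1r.
rewrite wE.
(* At either end of the word the letter 1 is dropped and the parity of the length changes, which a
   boundary cut makes up for. Inside the word its neighbours lie in the same algebra and fuse into
   one letter, so the length drops by two and the parity stays. *)
case: (lastP p) pP Ap tP pc ptn By wE {Awp ptE ptP yE Ay0 y0 IHt B1 BD BZ BM}
    => [|q x] pP Ap tP pc ptn By wE.
  rewrite /= in tP ptn By *.
  by rewrite add0n phi1 !mul1r (IHn _ _ _ tP) //; case: odd => /=; rewrite ?subr0 ?subrr.
case: t tP At ptn {wE} => [|z t] tP At ptn.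
  rewrite cats0 cut_sum_rcons1 mul1r (IHn b) //.
    rewrite addn0 -signr_odd; case: odd => /=; first by rewrite expr1 mulN1r opprK add0r.
    by rewrite expr0 mul1r subrr.
  by move: ptn; rewrite size_cat /= addn1.
rewrite !cat_rcons cut_sum_merge.
rewrite -cats1 in pP; have /alternating_cat[qP /= [Bx _]] := pP.
rewrite size_rcons /= !addbN /= in tP.
have [Bz tP'] := tP.
rewrite (IHn b).
- rewrite !size_rcons !size_cat /= !addnS /= negbK.
  by rewrite !word_prod_cat /= -!mulrA.
- by move: ptn; rewrite cat_rcons !size_cat /= !addnS => /ltnW.
- apply/alternating_cat; split => //=; split; last by rewrite negbK in tP' *.
  by have [_ _ _ BM] := B_alg (b (+) odd (size q)); apply: BM => //; rewrite negbK in Bz.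
Qed.

End AlternatingWords.

(** * Formal power series *)

Section FormalPowerSeries.
Context {K : fieldType}.

Record fps := Fps { fcoef : nat -> K }.

HB.instance Definition _ := gen_eqMixin fps.
HB.instance Definition _ := gen_choiceMixin fps.

Implicit Types f g h : fps.
Local Notation "f @_ n" := (fcoef f n) (at level 3, n at level 2).

Lemma fpsP f g : (forall n, f@_n = g@_n) -> f = g.
Proof. by case: f => f; case: g => g /= /funext ->. Qed.

Definition fps_add f g := Fps (fun n => f@_n + g@_n).
Definition fps_opp f := Fps (fun n => - f@_n).
Definition fps_mul f g := Fps (fun n => \sum_(i < n.+1) f@_i * g@_(n - i)).
Definition fpsC (c : K) := Fps (fun n => if n is 0 then c else 0).
Definition fpsX := Fps (fun n => (n == 1)%:R).

Fact fps_addA : associative fps_add.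
Proof. by move=> f g h; apply: fpsP => n; apply: addrA. Qed.
Fact fps_addC : commutative fps_add.
Proof. by move=> f g; apply: fpsP => n; apply: addrC. Qed.
Fact fps_add0 : left_id (fpsC 0) fps_add.
Proof. by move=> f; apply: fpsP => -[|n]; apply: add0r. Qed.
Fact fps_addN : left_inverse (fpsC 0) fps_opp fps_add.
Proof. by move=> f; apply: fpsP => -[|n]; apply: addNr. Qed.

HB.instance Definition _ :=
  GRing.isZmodule.Build fps fps_addA fps_addC fps_add0 fps_addN.

Let trunc N f := \poly_(i < N) f@_i.

(** A coefficient of a product sees only truncations of the factors, so the ring laws are inherited
    from polynomials. *)
Lemma fps_mul_trunc N f g n : (n < N)%N ->
  (fps_mul f g)@_n = (trunc N f * trunc N g)`_n.
Proof.
move=> nN; rewrite coefM; apply: eq_bigr => i _.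
rewrite !coef_poly (leq_ltn_trans (leq_subr _ _) nN).
by rewrite (leq_ltn_trans _ nN) // -ltnS.
Qed.

Fact fps_mulC : commutative fps_mul.
Proof.
by move=> f g; apply: fpsP => n; rewrite !(fps_mul_trunc _ _ (ltnSn n)) mulrC.
Qed.

Fact fps_mulA : associative fps_mul.
Proof.
move=> f g h; apply: fpsP => n.
have E (p q q' : {poly K}) : (forall i, (i <= n)%N -> q`_i = q'`_i) -> (p * q)`_n = (p * q')`_n.
  by move=> qq; rewrite !coefM; apply: eq_bigr => i _; rewrite qq ?leq_subr.
have T f1 f2 i : (i <= n)%N -> (trunc n.+1 (fps_mul f1 f2))`_i =
    (trunc n.+1 f1 * trunc n.+1 f2)`_i.
  by move=> i_n; rewrite coef_poly ltnS i_n (@fps_mul_trunc n.+1).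
rewrite !(fps_mul_trunc _ _ (ltnSn n)) (E _ _ _ (T _ _)) mulrA.
by rewrite ![_ * trunc _ h]mulrC; apply: E => i i_n; rewrite T.
Qed.

Fact fps_mul1 : left_id (fpsC 1) fps_mul.
Proof.
move=> f; apply: fpsP => n /=; rewrite big_ord_recl big1 => [|i _ /=].
  by rewrite mul1r addr0 subn0.
by rewrite mul0r.
Qed.

Fact fps_mulDl : left_distributive fps_mul fps_add.
Proof.
move=> f g h; apply: fpsP => n /=; rewrite -big_split /=.
by apply: eq_bigr => i _; rewrite mulrDl.
Qed.

Fact fps_1neq0 : fpsC 1 != 0.
Proof. by apply/eqP => /(congr1 (fcoef ^~ 0)) /eqP; rewrite oner_eq0. Qed.

HB.instance Definition _ := GRing.Zmodule_isComNzRing.Build fps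
  fps_mulA fps_mulC fps_mul1 fps_mulDl fps_1neq0.

Lemma fcoefD f g n : (f + g)@_n = f@_n + g@_n. Proof. by []. Qed.
Lemma fcoefN f n : (- f)@_n = - f@_n. Proof. by []. Qed.
Lemma fcoefB f g n : (f - g)@_n = f@_n - g@_n. Proof. by []. Qed.
Lemma fcoefM f g n : (f * g)@_n = \sum_(i < n.+1) f@_i * g@_(n - i).
Proof. by []. Qed.
Lemma fcoefM_trunc N f g n : (n < N)%N -> (f * g)@_n = (trunc N f * trunc N g)`_n.
Proof. exact: fps_mul_trunc. Qed.
Lemma fcoef0M f g : (f * g)@_0 = f@_0 * g@_0.
Proof. by rewrite fcoefM big_ord1. Qed.
Lemma fcoefC c n : (fpsC c)@_n = if n is 0 then c else 0. Proof. by []. Qed.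
Lemma fcoef1 n : (1 : fps)@_n = if n is 0 then 1 else 0. Proof. by []. Qed.
Lemma fcoef0 n : (0 : fps)@_n = 0. Proof. by case: n. Qed.
Lemma fcoefCM c f n : (fpsC c * f)@_n = c * f@_n.
Proof.
rewrite fcoefM big_ord_recl big1 => [|i _]; last by rewrite /= mul0r.
by rewrite addr0 /= subn0.
Qed.
Lemma fcoefXM f n : (fpsX * f)@_n = if n is m.+1 then f@_m else 0.
Proof.
case: n => [|n]; first by rewrite fcoef0M mul0r.
rewrite fcoefM big_ord_recl mul0r add0r big_ord_recl mul1r big1 ?addr0 /=.
  by rewrite subn1.
by move=> i _; rewrite mul0r.
Qed.

Fact fpsC_additive : {morph fpsC : x y / x - y}.
Proof. by move=> x y; apply: fpsP => -[|n] //=; rewrite ?subr0. Qed.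
Fact fpsC_multiplicative : {morph fpsC : x y / x * y} * (fpsC 1 = 1).
Proof. by split=> // x y; apply: fpsP => -[|n]; rewrite fcoefCM //= mulr0. Qed.
HB.instance Definition _ := GRing.isZmodMorphism.Build K fps fpsC fpsC_additive.
HB.instance Definition _ :=
  GRing.isMonoidMorphism.Build K fps fpsC (fpsC_multiplicative.2, fpsC_multiplicative.1).

Lemma fps_divX f : f@_0 = 0 -> exists g, f = fpsX * g.
Proof.
move=> f0; exists (Fps (fun n => f@_n.+1)); apply: fpsP => -[|n];
by rewrite fcoefXM.
Qed.

Lemma fpsX_reg f : fpsX * f = 0 -> f = 0.
Proof.
move=> Xf; apply: fpsP => n; have : (fpsX * f)@_n.+1 = 0 by rewrite Xf fcoef0.
by rewrite fcoefXM fcoef0.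
Qed.

(** The elimination cancels only factors of order zero or one; the regularity of such series stands
    in for a field of fractions. *)
Lemma fps_unit_reg f g : f@_0 != 0 -> f * g = 0 -> g = 0.
Proof.
move=> f0 fg; apply: fpsP => n; rewrite fcoef0.
have [m] := ubnP n; elim: m n => // m IH n; rewrite ltnS => nm.
have : (f * g)@_n = 0 by rewrite fg fcoef0.
rewrite fcoefM big_ord_recl subn0 big1 ?addr0.
  by move/eqP; rewrite mulf_eq0 (negbTE f0) => /eqP.
move=> i _; rewrite IH ?mulr0 //; apply: leq_trans nm.
by rewrite ltn_subrL /=; case: n i => // -[].
Qed.

Lemma fps_order1_reg f g : f@_0 = 0 -> f@_1 != 0 -> f * g = 0 -> g = 0.
Proof.
move=> /fps_divX[h ->]; rewrite fcoefXM -mulrA => h0 /fpsX_reg.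
exact: fps_unit_reg.
Qed.

(** Geometric series in [1 - f], which has no constant term: the coefficient of index n no longer
    changes after n + 1 terms. *)
Lemma fps_inv f : f@_0 = 1 -> exists g, f * g = 1.
Proof.
move=> f0; pose y : fps := 1 - f.
have y0 : y@_0 = 0 by rewrite fcoefB f0 fcoef1 subrr.
have yk k j : (j < k)%N -> (y ^+ k)@_j = 0.
  elim: k j => // k IH j; rewrite ltnS => jk; rewrite exprS fcoefM big_ord_recl.
  rewrite y0 mul0r add0r big1 // => i _; rewrite IH ?mulr0 //= /bump leq0n add1n.
  by case: j i jk => [[]//|j] i jk; rewrite subSS (leq_ltn_trans (leq_subr _ _)).
pose S n : fps := \sum_(k < n) y ^+ k.
have SE n j m : (j < n)%N -> (S (n + m)%N)@_j = (S n)@_j.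
  move=> jn; elim: m => [|m IH]; first by rewrite addn0.
  rewrite addnS [S _.+1]/S big_ord_recr fcoefD -/(S _) IH yk ?addr0 //.
  by rewrite (leq_trans jn) ?leq_addr.
exists (Fps (fun n => (S n.+1)@_n)); apply: fpsP => n.
have -> : (f * Fps (fun n => (S n.+1)@_n))@_n = (f * S n.+1)@_n.
  rewrite !fcoefM; apply: eq_bigr => i _ /=; congr (_ * _).
  by rewrite -(@SE (n - i).+1 _ i) // addSn subnK // -ltnS.
have -> : f = 1 - y by rewrite /y opprB addrCA subrr addr0.
have -> : (1 - y) * S n.+1 = 1 - y ^+ n.+1.
  by rewrite -{2}(expr1n _ n.+1) subrXX /S; congr (_ * _); apply: eq_bigr => i _; rewrite expr1n mul1r.
by rewrite fcoefB yk ?subr0.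
Qed.

(* A series [w] of order one can be substituted in a power series, and the
   substitution is injective. *)
Lemma fps_horner_order1 (w y : fps) (F : {poly K}) N : w@_0 = 0 -> w@_1 != 0 ->
  (map_poly fpsC F).[w] = w ^+ N * y -> forall k, (k < N)%N -> F`_k = 0.
Proof.
move=> w0 w1; elim: N F => // N IH F.
elim/poly_ind: F => [|F c _] Fw k kN; first by rewrite coef0.
move: Fw; rewrite rmorphD rmorphM /= map_polyX map_polyC /= hornerMXaddC => Fw.
have c0 : c = 0.
  have : (w ^+ N.+1 * y)@_0 = 0 by rewrite exprS !fcoef0M w0 !mul0r.
  by rewrite -Fw fcoefD fcoef0M w0 mulr0 add0r.
rewrite c0 addr0 coefMX; case: k kN => // k kN; apply: IH kN.
apply/eqP; rewrite -subr_eq0; apply/eqP/(fps_order1_reg w0 w1).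
move: Fw; rewrite c0 rmorph0 addr0 mulrC => Fw.
by rewrite mulrBr Fw exprS mulrA subrr.
Qed.

(** Unfolding the recursion n + 1 times replaces [G 0] by a polynomial in [w], up to a multiple of
    [w ^+ n.+1]. The relation then says that a polynomial [F] evaluated at [w] is divisible by
    [w ^+ n.+1], and injectivity of the substitution kills its coefficient of index n, which is that
    of the target equation. *)
Lemma fps_subst_quadratic (w : fps) (G : nat -> fps) (m : nat -> K) (a0 a b c d e : K) :
  w@_0 = 0 -> w@_1 != 0 -> (forall j, G j = fpsC (m j) + w * G j.+1) ->
  let quad (p x : fps) := fpsC a0 + fpsC a * p + fpsC b * p ^+ 2 +
    x * (fpsC c + fpsC d * p + fpsC e * p ^+ 2) in
  quad (G 0) w = 0 -> quad (Fps m) fpsX = 0.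
Proof.
move=> w0 w1 GE quad Qw; apply: fpsP => n; rewrite fcoef0.
pose p := \poly_(k < n.+1) m k.
have Gp N : G 0 = (map_poly fpsC (\poly_(k < N) m k)).[w] + w ^+ N * G N.
  elim: N => [|N IH].
    by rewrite poly_def big_ord0 rmorph0 horner0 add0r expr0 mul1r.
  rewrite {1}IH {1}GE !poly_def big_ord_recr /= rmorphD hornerD /=.
  by rewrite map_polyZ map_polyXn !hornerE exprS; ring.
pose F : {poly K} := a0%:P + a%:P * p + b%:P * p ^+ 2 +
  'X * (c%:P + d%:P * p + e%:P * p ^+ 2).
pose agree (q : {poly K}) f := forall i, (i <= n)%N -> q`_i = f@_i.
have agreeD q f q' f' : agree q f -> agree q' f' -> agree (q + q') (f + f').
  by move=> qf qf' i i_n; rewrite coefD fcoefD qf ?qf'.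
have agreeM q f q' f' : agree q f -> agree q' f' -> agree (q * q') (f * f').
  move=> qf qf' i i_n; rewrite coefM fcoefM; apply: eq_bigr => j _.
  by rewrite qf ?qf' // ?(leq_trans (leq_subr _ _)) // (leq_trans _ i_n) // -ltnS.
have agreeC x : agree x%:P (fpsC x) by move=> [|i] _; rewrite coefC.
have agreeX : agree 'X fpsX by move=> i _; rewrite coefX.
have agreep : agree p (Fps m) by move=> i i_n; rewrite coef_poly ltnS i_n.
have FE : F`_n = (quad (Fps m) fpsX)@_n.
  suff : agree F (quad (Fps m) fpsX) by apply.
  by rewrite /F /quad !expr2; repeat first [exact: agreeC | exact: agreeX | exact: agreep | apply agreeD | apply agreeM].
rewrite -FE.
(* Write P for the value of [p] at [w], so that P = G_0 - w^(n+1) G_(n+1). Then P - G_0 and P^2 -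
   G_0^2 = (P - G_0) (P + G_0) are both divisible by w^(n+1), and the witness collects their
   cofactors. *)
apply: (@fps_horner_order1 w (- (fpsC a * G n.+1 + fpsC b * G n.+1 * (G 0 + (map_poly fpsC p).[w])
  + w * (fpsC d * G n.+1 + fpsC e * G n.+1 * (G 0 + (map_poly fpsC p).[w])))) F n.+1) => //.
rewrite /F !(rmorphD, rmorphM, rmorphXn) /= !map_polyC map_polyX !hornerE /=.
have -> : (map_poly fpsC p).[w] = G 0 - w ^+ n.+1 * G n.+1.
  by rewrite [G 0](Gp n.+1) addrK.
move: Qw; rewrite /quad => Qw.
rewrite -[LHS]subr0 -Qw; ring.
Qed.

End FormalPowerSeries.
Arguments fps : clear implicits.

(** * Mixed moments and subordination *)

Section MixedMoments.
Context {R : realType} {H : hilbertType R}.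
Context (A : set 'B(H)) (phi : 'B(H) -> R[i]).
Hypothesis Aphi : wstar_probability_space A phi.

Implicit Types X Y Z S T : 'B(H).

Let A_alg : unital_subalgebra A.
Proof. by have [] := wstar_vna Aphi. Qed.

Lemma vna_exp X n : A X -> A (X ^+ n).
Proof.
have [A1 _ _ AM] := A_alg.
by move=> AX; elim: n => [|n IH]; rewrite ?expr0 // exprS; apply: (AM).
Qed.

Lemma wstar_sub S T : A S -> A T -> A (S - T) /\ phi (S - T) = phi S - phi T.
Proof.
have [A1 AD AZ AM] := A_alg.
move=> AS AT; have AN : A (-1 *: T) by apply: AZ.
by rewrite -scaleN1r; split; [exact: AD|rewrite (wstar_add Aphi) // (wstar_scale Aphi) // mulN1r].
Qed.

Lemma exprMC X Y k : (X * Y) ^+ k * X = X * (Y * X) ^+ k.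
Proof.
elim: k => [|k IH]; first by rewrite !expr0 mul1r mulr1.
by rewrite exprS -[LHS]mulrA IH [in RHS]exprS !mulrA.
Qed.

Section TwoAlgebras.
Context (B : bool -> set 'B(H)).
Hypothesis B_alg : forall b, unital_subalgebra (B b).
Hypothesis B_sub : forall b, B b `<=` A.
Hypothesis B_free : free_subalgebras phi B.

Let rep X Y n : seq 'B(H) := flatten (nseq n [:: X; Y]).

(** Cuts between blocks X Y and cuts inside a block alternate in sign and are paired; the last
    summand is the cut at the end of the word. The power [m] in the accumulator serves the
    induction. *)
Lemma cut_sum_rep X Y f m n :
  cut_sum phi ((X * Y) ^+ m) (rep X Y n ++ [:: X; Y * f]) =
  \sum_(i < n.+1) (phi ((X * Y) ^+ (m + i)) * phi ((X * Y) ^+ (n.+1 - i) * f) -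
     phi ((X * Y) ^+ (m + i) * X) * phi (Y * (X * Y) ^+ (n - i) * f)) +
  phi ((X * Y) ^+ (m + n.+1) * f).
Proof.
have prodE k : word_prod (rep X Y k ++ [:: X; Y * f]) = (X * Y) ^+ k.+1 * f.
  elim: k => [|k IH]; first by rewrite /= mulr1 mulrA.
  by rewrite /= IH [in RHS]exprS !mulrA.
elim: n m => [|n IH] m.
  rewrite big_ord1 /= !mulr1 addn0 !subn0 addn1.
  by rewrite (exprSr _ m) expr1 -!mulrA (wstar_one Aphi); ring.
rewrite [LHS]/= -/(rep X Y n) !prodE -[_ * X * Y]mulrA -exprSr IH.
rewrite [in RHS]big_ord_recl addn0 !subn0.
under [in RHS]eq_bigr => i _ do rewrite /= /bump leq0n add1n -addSnnS !subSS.
have -> : X * (Y * ((X * Y) ^+ n.+1 * f)) = (X * Y) ^+ n.+2 * f.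
  by rewrite [in RHS]exprS !mulrA.
by rewrite [(m.+1 + n.+1)%N]addSnnS [Y * (_ * f)]mulrA; ring.
Qed.

(** Absorbing [f] into the last letter gives an alternating word of even length. Its cut sum is its
    own moment, which is also the contribution of the cut at its end; what remains balances the cuts
    between blocks against those inside blocks. *)
Lemma free_mixed_moments b X Y f n : B b X -> B (~~ b) Y -> B (~~ b) f ->
  \sum_(i < n.+1) phi ((X * Y) ^+ i) * phi ((X * Y) ^+ (n.+1 - i) * f) =
  \sum_(i < n.+1) phi ((X * Y) ^+ i * X) * phi (Y * (X * Y) ^+ (n - i) * f).
Proof.
move=> BX BY Bf; have [_ _ _ BM] := B_alg (~~ b).
have wP : alternating_word B b (rep X Y n ++ [:: X; Y * f]).
  elim: n => [|n IH] /=; first by split=> //; split=> //; apply: BM.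
  by rewrite negbK; split=> //; split.
have := cut_sum_rep X Y f 0 n; rewrite expr0 (cut_sum_alternating A_alg (wstar_add Aphi) (wstar_scale Aphi)
  (wstar_one Aphi) B_alg B_sub B_free wP).
have -> : odd (size (rep X Y n ++ [:: X; Y * f])) = false.
  by rewrite size_cat oddD /= addbF /rep; elim: (n) => //= k ->.
have -> : word_prod (rep X Y n ++ [:: X; Y * f]) = (X * Y) ^+ n.+1 * f.
  elim: (n) => [|k IH]; first by rewrite /= mulr1 mulrA.
  by rewrite /= IH [in RHS]exprS !mulrA.
rewrite add0n => /esym/(canRL (addrK _)); rewrite subrr sumrB => /eqP.
by rewrite subr_eq0 => /eqP.
Qed.

Definition mixed_fps X Y j : fps R[i] := Fps (fun n => phi ((X * Y) ^+ n * Y ^+ j)).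

Lemma mixed_fpsC X Y : A X -> A Y -> mixed_fps X Y 0 = mixed_fps Y X 0.
Proof.
move=> AX AY; have [A1 _ _ AM] := A_alg.
apply: fpsP => -[|n] /=; rewrite !expr0 ?mulr1 //.
rewrite exprSr mulrA exprMC (wstar_tracial Aphi) ?mulrA -?exprS //.
by apply: (AM) => //; apply/vna_exp/AM.
Qed.

(** The previous identity with [f = Y ^+ j]. Traciality turns the two factors of an inner cut into
    coefficients of [mixed_fps Y X 1] and [mixed_fps X Y j.+1]; removing the constant coefficient
    leaves the powers of index at least 1 that occur on the other side. *)
Lemma mixed_fps_rec b X Y j : B b X -> B (~~ b) Y ->
  mixed_fps X Y 0 * (mixed_fps X Y j - fpsC (phi (Y ^+ j))) =
  fpsX * (mixed_fps Y X 1 * mixed_fps X Y j.+1).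
Proof.
move=> BX BY; have AX := B_sub BX; have AY := B_sub BY.
have [A1 _ _ AM] := A_alg.
apply: fpsP => -[|n].
  by rewrite fcoefXM fcoef0M fcoefB fcoefC /= !expr0 !mul1r subrr mulr0.
rewrite fcoefXM !fcoefM big_ord_recr /= subnn !expr0 !mul1r subrr mulr0 addr0.
have BYj : B (~~ b) (Y ^+ j).
  have [B1 _ _ BM] := B_alg (~~ b).
  by elim: j => [|j IH]; rewrite ?expr0 // exprS; apply: BM.
transitivity (\sum_(i < n.+1) phi ((X * Y) ^+ i) * phi ((X * Y) ^+ (n.+1 - i) * Y ^+ j)).
  apply: eq_bigr => i _; rewrite ?expr0 mulr1; congr (_ * _).
  by rewrite subSn ?subr0 // -ltnS.
rewrite (free_mixed_moments n BX BY BYj); apply: eq_bigr => i _.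
rewrite exprMC expr1 [phi (X * _)](wstar_tracial Aphi) //; last exact/vna_exp/AM.
rewrite -!mulrA [phi (Y * _)](wstar_tracial Aphi) //; last by apply: (AM); apply: vna_exp => //; apply: (AM).
by rewrite -mulrA -exprSr.
Qed.

End TwoAlgebras.

Section ConditionalMoments.
Context (U V rV : 'B(H)) (E : 'B(H) -> 'B(H)) (c1 c2 : R[i]).
Hypotheses (AU : A U) (ArV : A rV) (VE : rV * rV = V).
Hypothesis E_cexp : cond_exp_given A phi (rV * U * rV) E.
Hypothesis E1 : E (V - rV * U * rV) = c1 *: (1 : 'B(H)).
Hypothesis E2 : E ((V - rV * U * rV) ^+ 2) = c2 *: (1 : 'B(H)).

Let W := rV * U * rV.
Let AV : A V. Proof. by rewrite -VE; have [_ _ _] := A_alg; apply. Qed.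
Let AW : A W.
Proof. by have [_ _ _ AM] := A_alg; apply: (AM) => //; apply: (AM). Qed.

(** [rV] intertwines [W] and [U * V]. Together with traciality this transports the moments of [W] to
    words in [U] and [V], to which freeness applies. *)
Let WrV n : W ^+ n * rV = rV * (U * V) ^+ n.
Proof.
elim: n => [|n IH]; first by rewrite mul1r mulr1.
by rewrite exprS -mulrA IH /W [in RHS]exprS -VE !mulrA.
Qed.

Let phiW n : phi (W ^+ n) = fcoef (mixed_fps U V 0) n.
Proof.
have [_ _ _ AM] := A_alg; have AWn k : A ((U * V) ^+ k) by apply/vna_exp/AM.
rewrite /= expr0 mulr1; case: n => [|n] //.
have -> : W ^+ n.+1 = W ^+ n * rV * (U * rV) by rewrite exprSr /W !mulrA.
rewrite WrV -mulrA (wstar_tracial Aphi) //; last by apply: (AM) => //; apply: (AM).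
by rewrite -!mulrA VE -exprSr.
Qed.

Let phiVW j n : phi (V ^+ j.+1 * W ^+ n) = fcoef (mixed_fps U V j.+1) n.
Proof.
have [_ _ _ AM] := A_alg; have AWn k : A (W ^+ k) by apply: vna_exp.
have AUVn k : A ((U * V) ^+ k) by apply/vna_exp/AM.
have AVj k : A (V ^+ k) by apply: vna_exp.
have -> : V ^+ j.+1 = rV * (V ^+ j * rV).
  by rewrite -VE -expr2 -!exprM -exprSr -exprS mulnS.
rewrite -[LHS]/(phi _) -mulrA (wstar_tracial Aphi) //; last by apply: (AM) => //; apply: (AM).
rewrite -mulrA WrV -mulrA [rV * (rV * _)]mulrA VE mulrA -exprSr.
by rewrite (wstar_tracial Aphi).
Qed.

(** The pairing may be tested on [W ^+ n], since every von Neumann algebra containing [W] contains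
    its powers. *)
Lemma cexp_const X c n : A X -> E X = c *: (1 : 'B(H)) -> phi (X * W ^+ n) = c * phi (W ^+ n).
Proof.
move=> AX EX; rewrite (cexp_pairing E_cexp AX).
  by rewrite EX -bop_scaleAl mul1r (wstar_scale Aphi) //; apply: vna_exp.
move=> C [[C1 _ _ CM] _ _] CW.
by elim: n => [|n IH]; rewrite ?expr0 // exprS; apply: CM.
Qed.

Lemma cexp_moment1 n : fcoef (mixed_fps U V 1) n - fcoef (mixed_fps U V 0) n.+1 =
  c1 * fcoef (mixed_fps U V 0) n.
Proof.
have [_ _ _ AM] := A_alg; have AWn k : A (W ^+ k) by apply: vna_exp.
rewrite -phiVW -!phiW -(cexp_const _ _ E1); last by have [] := wstar_sub AV AW.
by rewrite mulrBl -exprS (wstar_sub _ _).2 //; apply: (AM).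
Qed.

(** [V] and [W] need not commute, but the two cross terms of the square have equal moments against
    [W ^+ n] by traciality, whence the factor 2. *)
Lemma cexp_moment2 n : fcoef (mixed_fps U V 2) n - 2 * fcoef (mixed_fps U V 1) n.+1 +
  fcoef (mixed_fps U V 0) n.+2 = c2 * fcoef (mixed_fps U V 0) n.
Proof.
have [_ AD _ AM] := A_alg; have AWn k : A (W ^+ k) by apply: vna_exp.
have [AVW _] := wstar_sub AV AW.
rewrite -phiVW -phiVW expr1 -!phiW -(cexp_const _ _ E2); last exact: vna_exp.
have -> : (V - W) ^+ 2 * W ^+ n =
    (V ^+ 2 * W ^+ n - V * W ^+ n.+1) - (W * (V * W ^+ n) - W ^+ n.+2).
  by rewrite !expr2 mulrBl !mulrBr !mulrBl !exprS !mulrA.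
have AVWk k : A (V * W ^+ k) by apply: (AM).
have AVV : A (V ^+ 2 * W ^+ n) by apply: (AM) => //; apply: (AM).
have [A1' E1'] := wstar_sub AVV (AVWk n.+1).
have [A2' E2'] := wstar_sub (AM _ _ AW (AVWk n)) (AWn n.+2).
rewrite (wstar_sub A1' A2').2 E1' E2' [phi (W * _)](wstar_tracial Aphi) //.
by rewrite -mulrA -exprSr; ring.
Qed.

End ConditionalMoments.
End MixedMoments.

(** * Elimination of the subordination series *)

Section SubordinationEquations.
Context {K : fieldType}.
Context (G H : nat -> fps K) (m u : nat -> K) (c1 c2 al : K).
Local Notation C := (@fpsC K).
Local Notation X := (@fpsX K).
Hypothesis G_rec : forall j, G 0 * (G j - C (m j)) = X * (H 1 * G j.+1).
Hypothesis H_rec : forall j, H 0 * (H j - C (u j)) = X * (G 1 * H j.+1).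
Hypothesis GH : H 0 = G 0.
Hypothesis G00 : fcoef (G 0) 0 = 1.
Hypothesis G10 : fcoef (G 1) 0 = m 1.
Hypothesis H10 : fcoef (H 1) 0 = u 1.
Hypotheses (m0 : m 0 = 1) (m1_neq0 : m 1 != 0) (u1_neq0 : u 1 != 0).
Hypothesis moment1 :
  forall n, fcoef (G 1) n - fcoef (G 0) n.+1 = c1 * fcoef (G 0) n.
Hypothesis moment2 : forall n, fcoef (G 2) n - 2 * fcoef (G 1) n.+1 +
  fcoef (G 0) n.+2 = c2 * fcoef (G 0) n.
Hypotheses (c1_neq0 : c1 != 0) (alE : al * c1 = c2 - c1 ^+ 2).

Let fps_moment1 : X * G 1 - (G 0 - 1) = C c1 * (X * G 0).
Proof.
apply: fpsP => -[|n]; rewrite fcoefB fcoefB fcoefCM !fcoefXM fcoef1.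
  by rewrite G00 subrr subr0 mulr0.
by rewrite subr0 moment1.
Qed.

(** The relation between coefficients is shifted by two, so those of index 0 and 1 of [G 0] are
    removed by hand; the second is [m 1 - c1] by the first regression condition. *)
Let fps_moment2 : X ^+ 2 * G 2 - 2 * (X * (G 1 - C (m 1))) +
  (G 0 - 1 - C (m 1 - c1) * X) = C c2 * (X ^+ 2 * G 0).
Proof.
have p1 : fcoef (G 0) 1 = m 1 - c1.
  by have := moment1 0; rewrite G00 G10 mulr1 => <-; ring.
have two n (f : fps K) : fcoef (2 * f) n = 2 * fcoef f n.
  by rewrite !mulr_natl !mulr2n fcoefD.
apply: fpsP => -[|[|n]];
  rewrite expr2 -!mulrA fcoefD !fcoefB !fcoefCM two !fcoefXM /= ?fcoefXM ?fcoefB ?fcoefC /=.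
- by rewrite ?fcoef1 G00; ring.
- by rewrite ?fcoef1 p1 G10; ring.
- by rewrite ?fcoef1 -moment2; ring.
Qed.

Lemma subordination_equations :
  (Fps m - 1 = X * Fps m * (C al * (Fps m - 1) + C (m 1))) /\
  ((Fps u - 1) * (C al * (Fps u - 1) + C (m 1)) =
   X * Fps u * (C al * (Fps u - 1) + C (m 1 - c1))).
Proof.
have [g G0g] := fps_inv G00.
pose w := X * H 1 * g; pose eta := X * G 1 * g; pose psi := G 0 - 1.
have Gw j : G j = C (m j) + w * G j.+1.
  have -> : w * G j.+1 = (X * (H 1 * G j.+1)) * g by rewrite /w; ring.
  by rewrite -G_rec mulrAC G0g; ring.
have Heta j : H j = C (u j) + eta * H j.+1.
  have -> : eta * H j.+1 = (X * (G 1 * H j.+1)) * g by rewrite /eta; ring.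
  by rewrite -H_rec GH mulrAC G0g; ring.
have g0 : fcoef g 0 = 1.
  by rewrite -[LHS]mul1r -G00 -fcoef0M G0g.
have w0 : fcoef w 0 = 0 by rewrite /w -mulrA fcoefXM.
have w1 : fcoef w 1 != 0 by rewrite /w -mulrA fcoefXM fcoef0M H10 g0 mulr1.
have eta0 : fcoef eta 0 = 0 by rewrite /eta -mulrA fcoefXM.
have eta1 : fcoef eta 1 != 0 by rewrite /eta -mulrA fcoefXM fcoef0M G10 g0 mulr1.
have G0E : G 0 = 1 + psi by rewrite /psi addrCA subrr addr0.
have psiE : psi = w * G 1 by rewrite /psi {1}Gw m0 rmorph1 addrAC subrr add0r.
have psi_reg f : psi * f = 0 -> f = 0.
  rewrite psiE -mulrA => /(fps_order1_reg w0 w1).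
  by apply: fps_unit_reg; rewrite G10.
have psi_eq1 : X * psi = w * psi + C c1 * X * w * (1 + psi).
  rewrite -G0E; apply/eqP; rewrite -subr_eq0; apply/eqP.
  transitivity (w * (X * G 1 - (G 0 - 1) - C c1 * (X * G 0))).
    by rewrite -/psi {1}psiE; ring.
  by rewrite fps_moment1 subrr mulr0.
have wG1 : w * G 1 = psi by rewrite psiE.
have wwG2 : w ^+ 2 * G 2 = psi - w * C (m 1).
  by rewrite psiE (Gw 1); ring.
(* Division-free form of eta w = z psi / (1 + psi), the relation between the two subordination
   series of a free product. *)
have etaw : eta * w * (1 + psi) = X * psi.
  have -> : X * psi = X * (w * G 1) * (G 0 * g) by rewrite wG1 G0g mulr1.
  by rewrite -G0E /eta; ring.
have A0 : psi * (X - w) - C c1 * X * w * (1 + psi) = 0.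
  by rewrite mulrBr -[psi * X]mulrC psi_eq1; ring.
have B0 : X ^+ 2 * (psi - w * C (m 1)) - 2 * X * w * (psi - w * C (m 1)) +
    w ^+ 2 * (psi - C (m 1 - c1) * X) - C c2 * X ^+ 2 * w ^+ 2 * (1 + psi) = 0.
  rewrite -wwG2.
  transitivity (w ^+ 2 * (X ^+ 2 * G 2 - 2 * (X * (G 1 - C (m 1))) +
    (G 0 - 1 - C (m 1 - c1) * X) - C c2 * (X ^+ 2 * G 0))); last first.
    by rewrite fps_moment2 subrr mulr0.
  by rewrite G0E (Gw 1); ring.
have C0 : C c1 * (1 + psi) * (X - w) - C (m 1) * (X - w) + C c1 * w -
    C c2 * X * w * (1 + psi) = 0.
  (* Both [A0] and [B0] start with a power of [X - w] times psi. In [B0] minus [X - w] times [A0]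
     the term psi (X - w)^2 disappears and the rest is divisible by [X * w]. *)
  apply/(fps_order1_reg w0 w1)/fpsX_reg; rewrite -[RHS]B0 -[LHS]addr0.
  by rewrite -(mulr0 (X - w)) -A0 rmorphB; ring.
(* Eliminating [psi * (X - w)] between [C0] and [A0] leaves [c1 * w] times this expression. It is
   the free Poisson equation with jump [al] and mean [m 1 - c1], satisfied by the series [G 0]. *)
have psi_eqz : psi - X * (1 + psi) * (C al * psi + C (m 1 - c1)) = 0.
  apply: (@fps_unit_reg _ (C c1)) => //; apply/(fps_order1_reg w0 w1).
  rewrite -[RHS](mulr0 psi) -C0 -[RHS]subr0.
  rewrite -(mulr0 (C c1 * (1 + psi) - C (m 1))) -A0 rmorphB.
  have -> : C c2 = C al * C c1 + C c1 ^+ 2 by rewrite -rmorphM alE rmorphB rmorphXn subrK.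
  ring.
have psi_eqw : psi - w * (1 + psi) * (C al * psi + C (m 1)) = 0.
  apply: fpsX_reg; transitivity ((psi * (X - w) - C c1 * X * w * (1 + psi)) +
    w * (psi - X * (1 + psi) * (C al * psi + C (m 1 - c1)))).
    by rewrite rmorphB; ring.
  by rewrite A0 psi_eqz mulr0 addr0.
have etaE : eta - X * (C al * psi + C (m 1)) = 0.
  apply: psi_reg; transitivity (eta * (psi - w * (1 + psi) * (C al * psi + C (m 1))) +
    (C al * psi + C (m 1)) * (eta * w * (1 + psi) - X * psi)); first ring.
  by rewrite psi_eqw etaw subrr !mulr0 addr0.
have psi_eqeta : psi * (C al * psi + C (m 1)) -
    eta * (1 + psi) * (C al * psi + C (m 1 - c1)) = 0.
  transitivity ((C al * psi + C (m 1)) *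
      (psi - X * (1 + psi) * (C al * psi + C (m 1 - c1))) -
    (1 + psi) * (C al * psi + C (m 1 - c1)) * (eta - X * (C al * psi + C (m 1)))).
    ring.
  by rewrite psi_eqz etaE !mulr0 subr0.
split; apply/eqP; rewrite -subr_eq0; apply/eqP.
  (* The six scalars are the coefficients of the equation once it is expanded in powers of
     [G 0 = 1 + psi]; the same holds for the second application below. *)
  have := @fps_subst_quadratic K w G m (-1) 1 0 0 (al - m 1) (- al) w0 w1 Gw.
  rewrite /= => h; rewrite -[RHS]h; last by rewrite G0E -[RHS]psi_eqw; ring.
  ring.
have Heta0 : G 0 = H 0 by rewrite GH.
have := @fps_subst_quadratic K eta H u (al - m 1) (m 1 - 2 * al) al 0 (al + c1 - m 1) (- al)
  eta0 eta1 Heta.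
rewrite /= => h; rewrite -[RHS]h; first ring.
by rewrite -Heta0 G0E -[RHS]psi_eqeta; ring.
Qed.

End SubordinationEquations.

(** * Coefficients of the square root of a quadratic polynomial *)

Section FpsSquareRoot.
Context {K : numFieldType}.
Local Notation C := (@fpsC K).
Local Notation X := (@fpsX K).
Implicit Types f g s : fps K.

Definition fps_deriv f := Fps (fun n => n.+1%:R * fcoef f n.+1).

Lemma fps_derivM f g : fps_deriv (f * g) = fps_deriv f * g + f * fps_deriv g.
Proof.
apply: fpsP => n; rewrite fcoefD.
have -> : fcoef (fps_deriv (f * g)) n = n.+1%:R * fcoef (f * g) n.+1 by [].
pose t f := \poly_(i < n.+2) fcoef f i.
rewrite (@fcoefM_trunc _ n.+2) // mulr_natl -/(t f) -/(t g) -coef_deriv derivM coefD.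
rewrite !coefM !fcoefM; congr (_ + _); apply: eq_bigr => i _ /=.
  rewrite coef_deriv !coef_poly ltnS ltn_ord.
  by rewrite ltnS (leq_trans (leq_subr _ _)) // mulr_natl.
rewrite coef_deriv !coef_poly ltnS (leq_trans (ltnW (ltn_ord i))) //.
by rewrite ltnS ltnS leq_subr mulr_natl.
Qed.

(* The recurrence is read off [2 Delta s' = Delta' s], where [Delta = s^2]. *)
Lemma fps_sqrt_coef s (p q : K) (I : nat -> K) :
  fcoef s 0 = 1 -> s ^+ 2 = 1 - C p * X + C q * X ^+ 2 ->
  I 0 = (p ^+ 2 - 4 * q) / 8 ->
  (forall k, k.+3%:R * I k.+1 = (k%:R + 3 / 2) * p * I k - k%:R * q * I k.-1) ->
  fcoef s 1 = - p / 2 /\ forall n, fcoef s n.+2 = - I n.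
Proof.
move=> s0 sE I0 I_rec.
pose Delta : fps K := 1 - C p * X + C q * X ^+ 2.
have ode : 2 * Delta * fps_deriv s = fps_deriv Delta * s.
  by rewrite /Delta -sE [in RHS]expr2 fps_derivM expr2; ring.
have DeltaE n : fcoef Delta n = if n is 0 then 1 else if n is 1 then - p else
    if n is 2 then q else 0.
  rewrite /Delta expr2 fcoefD fcoefB !fcoefCM fcoef1.
  case: n => [|[|[|n]]]; rewrite fcoefXM /=; ring.
have dDelta : fps_deriv Delta = C (- p) + C (2 * q) * X.
  apply: fpsP => n; rewrite fcoefD fcoefCM fcoefC -[LHS]/(n.+1%:R * fcoef Delta n.+1) DeltaE.
  by case: n => [|[|n]] /=; ring.
have rec n : 2 * (n.+1%:R * fcoef s n.+1) - 2 * p * (n%:R * fcoef s n) +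
    2 * q * (if n is m.+1 then m%:R * fcoef s m else 0) =
    - p * fcoef s n + 2 * q * (if n is m.+1 then fcoef s m else 0).
  have := congr1 (fun f => fcoef f n) ode; rewrite dDelta /Delta.
  have -> : 2 * (1 - C p * X + C q * X ^+ 2) * fps_deriv s =
     C 2 * fps_deriv s - C (2 * p) * (X * fps_deriv s) +
     C (2 * q) * (X * (X * fps_deriv s)).
    rewrite !rmorphM rmorphMn rmorph1; ring.
  have -> : (C (- p) + C (2 * q) * X) * s = C (- p) * s + C (2 * q) * (X * s) by ring.
  have XS (f : fps K) k : fcoef (X * f) k.+1 = fcoef f k by rewrite fcoefXM.
  have X0 (f : fps K) : fcoef (X * f) 0 = 0 by rewrite fcoefXM.
  have dE k : fcoef (fps_deriv s) k = k.+1%:R * fcoef s k.+1 by [].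
  rewrite !fcoefD fcoefN !fcoefCM.
  by case: n => [|[|n]]; rewrite ?(XS, X0, dE) => <-; ring.
have s1 : fcoef s 1 = - p / 2.
  have := rec 0; rewrite /= s0 => e; apply: (@mulfI K 2); first by rewrite pnatr_eq0.
  transitivity (- p * 1 + 2 * q * 0); first by rewrite -e; ring.
  by field.
split=> // n.
have s2 : fcoef s 2 = - I 0.
  rewrite I0; have := rec 1; rewrite /= s0 s1 => e.
  apply: (@mulfI K (2 * 2)); first by rewrite mulf_neq0 ?pnatr_eq0.
  transitivity (- p * (- p / 2) + 2 * q * 1 + 2 * p * (1%:R * (- p / 2)) - 2 * q * (0%:R * 1)).
    by rewrite -e; ring.
  by field.
suff : fcoef s n.+2 = - I n /\ fcoef s n.+3 = - I n.+1 by case.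
elim: n => [|n [IH1 IH2]].
  (* At this index the recurrence still involves the coefficient of index 1, which is not of the
     form [- I n]. Its two occurrences cancel, in accordance with the factor 0 in front of
     [I 0.-1]. *)
  split=> //; have := rec 2; rewrite /= s2 s1 => e.
  apply: (@mulfI K (2 * 3)); first by rewrite mulf_neq0 ?pnatr_eq0.
  transitivity (- p * - I 0 + 2 * q * (- p / 2) + 2 * p * (2%:R * - I 0) - 2 * q * (1%:R * (- p / 2))).
    by rewrite -e; ring.
  have := I_rec 0; rewrite mul0r mul0r subr0 add0r => e1.
  transitivity (- (2 * (0.+3%:R * I 0.+1))); last by ring.
  by rewrite e1; field.
split=> //; have := rec n.+3; rewrite /= IH1 IH2 => e.
apply: (@mulfI K (2 * n.+4%:R)); first by rewrite mulf_neq0 ?pnatr_eq0.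
transitivity (- p * - I n.+1 + 2 * q * - I n + 2 * p * (n.+3%:R * - I n.+1) -
    2 * q * (n.+2%:R * - I n)).
  by rewrite -e; ring.
transitivity (- (2 * (n.+1.+3%:R * I n.+2))); last by ring.
by rewrite I_rec /=; field.
Qed.

End FpsSquareRoot.

(** * Semicircle integrals *)

Section SemicircleIntegrals.
Context {R : realType}.
Local Notation mu := (@lebesgue_measure R).
Implicit Types (a b x y : R) (f g F : R -> R).

Lemma is_derive_sqrt g x dg : 0 < g x -> is_derive x 1 g dg ->
  is_derive x 1 (fun y => Num.sqrt (g y)) (dg / (2 * Num.sqrt (g x))).
Proof.
move=> gx dgx; apply: is_derive_eq; last by rewrite mulrC.
exact: is_derive1_comp (is_derive1_sqrt gx) dgx.
Qed.

Lemma continuous_sqrt_comp g x : {for x, continuous g} ->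
  {for x, continuous (fun y => Num.sqrt (g y))}.
Proof. by move=> cg; apply: continuous_comp => //; apply: sqrt_continuous. Qed.

(* [half_arc y] is the arcsine of [Num.sqrt y], written with the half-angle
   formula so that it is continuous at both ends of the unit interval. *)
Definition half_arc y := 2 * atan (Num.sqrt y / (1 + Num.sqrt (1 - y))).

Lemma half_arc0 : half_arc 0 = 0.
Proof. by rewrite /half_arc sqrtr0 mul0r atan0 mulr0. Qed.

Lemma half_arc1 : half_arc 1 = pi / 2.
Proof.
rewrite /half_arc sqrtr1 subrr sqrtr0 addr0 divr1 atan1; by field.
Qed.

Lemma half_arc_continuous y : {for y, continuous half_arc}.
Proof.
apply: cvgM; first exact: cvg_cst.
apply: continuous_comp; last exact: continuous_atan.
apply: cvgM; first exact: sqrt_continuous.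
apply: cvgV; first by rewrite gt_eqF // ltr_pwDl // sqrtr_ge0.
apply: cvgD; first exact: cvg_cst.
apply: (@continuous_sqrt_comp (fun z => 1 - z)); apply: cvgB; [exact: cvg_cst|exact: cvg_id].
Qed.

Lemma is_derive_half_arc y : 0 < y < 1 ->
  is_derive y 1 half_arc (2 * (Num.sqrt y * Num.sqrt (1 - y)))^-1.
Proof.
move=> /andP[y0 y1].
have y1' : 0 < 1 - y by rewrite subr_gt0.
set s := Num.sqrt y; set t := Num.sqrt (1 - y).
have s0 : 0 < s by rewrite sqrtr_gt0.
have t0 : 0 < t by rewrite sqrtr_gt0.
have ds := is_derive_sqrt y0 (is_derive_id y 1).
have d1y : is_derive y 1 (fun z : R => 1 - z) (-1).
  apply: (is_derive_eq (is_deriveB (is_derive_cst (1 : R) y 1) (is_derive_id y 1))).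
  by rewrite sub0r.
have dt := @is_derive_sqrt (fun z => 1 - z) y (-1) y1' d1y.
have d1t : is_derive y 1 (fun z : R => 1 + Num.sqrt (1 - z)) (- 1 / (2 * t)).
  by apply: (is_derive_eq (is_deriveD (is_derive_cst (1 : R) y 1) dt)); rewrite add0r.
have t1 : 1 + Num.sqrt (1 - y) != 0 by rewrite -/t gt_eqF // ltr_pwDl // ltW.
have dV := @is_deriveV _ (fun z => 1 + Num.sqrt (1 - z)) y _ _ t1 d1t.
have dq := is_deriveM ds dV.
have dat := is_derive1_comp (is_derive1_atan _) dq.
apply: (is_derive_eq (is_deriveZ 2 dat)).
have st : s ^+ 2 + t ^+ 2 = 1 by rewrite !sqr_sqrtr ?(ltW y0) ?(ltW y1') // addrC subrK.
have s_neq0 : s != 0 by rewrite gt_eqF.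
have t_neq0 : t != 0 by rewrite gt_eqF.
have t1_neq0 : 1 + t != 0 by [].
transitivity (2 * ((1 + (s * (1 + t)^-1) ^+ 2)^-1 *
  (s * (- (1 + t) ^- 2 * (- 1 / (2 * t))) + (1 + t)^-1 * (1 / (2 * s))))).
  by [].
have -> : 1 + (s * (1 + t)^-1) ^+ 2 = 2 / (1 + t).
  transitivity ((1 + 2 * t + (s ^+ 2 + t ^+ 2)) / (1 + t) ^+ 2); first by field.
  by rewrite st; field.
transitivity ((s ^+ 2 + t ^+ 2 + t) / (2 * s * t * (1 + t))); last first.
  by rewrite st; field; rewrite t_neq0 s_neq0.
by field; rewrite ?t_neq0 ?s_neq0 ?t1_neq0.
Qed.

(** Differentiability is asked for only inside the interval: the primitives used below contain
    square roots that vanish at its ends. *)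
Lemma FTC_continuous f F a b : a < b -> {in `[a, b], forall x, {for x, continuous f}} ->
  {in `[a, b], forall x, {for x, continuous F}} ->
  {in `]a, b[, forall x, is_derive x 1 F (f x)} ->
  mu.-integrable `]a, b[ (EFin \o f) /\
  (\int[mu]_(x in `]a, b[) (f x)%:E = (F b - F a)%:E)%E.
Proof.
move=> ab cf cF dF.
have cfw : {within `[a, b], continuous f}.
  by apply: continuous_in_subspaceT => x; rewrite inE => /cf.
have intf : mu.-integrable `[a, b] (EFin \o f).
  exact: continuous_compact_integrable (@segment_compact _ a b) cfw.
have intfo : mu.-integrable `]a, b[ (EFin \o f).
  by apply: integrableS intf => //; apply: subset_itvW.
split=> //.
rewrite -(@integral_itv_bndoo _ a b _ true false); last first.
  exact: (measurable_int mu).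
rewrite (@continuous_FTC2 _ f F) //.
  split.
  - by move=> x xab; have [] := dF x xab.
  - by apply: cvg_at_right_filter; apply: cF; rewrite in_itv /= lexx ltW.
  - by apply: cvg_at_left_filter; apply: cF; rewrite in_itv /= lexx ltW.
by move=> x xab; rewrite derive1E; have [_ ->] := dF x xab.
Qed.

End SemicircleIntegrals.

Section SemicircleMoments.
Context {R : realType}.
Local Notation mu := (@lebesgue_measure R).
Implicit Types (a b x y : R) (f g F : R -> R).

Definition semicircle a b x := Num.sqrt ((x - a) * (b - x)).

Lemma is_derive_half_arc_comp g x dg r : 0 < r -> 0 < g x < 1 ->
  g x * (1 - g x) = r ^+ 2 -> is_derive x 1 g dg ->
  is_derive x 1 (half_arc \o g) (dg / (2 * r)).
Proof.
move=> r0 g01 gr dgx.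
apply: (is_derive_eq (is_derive1_comp (is_derive_half_arc g01) dgx)).
have /andP[g0 _] := g01.
by rewrite -sqrtrM ?(ltW g0) // gr sqrtr_sqr gtr0_norm // mulrC.
Qed.

Section Interval.
Variables a b : R.
Hypothesis ab : a < b.
Local Notation h := (semicircle a b).

Lemma semicircle_continuous x : {for x, continuous h}.
Proof.
apply: (@continuous_sqrt_comp _ (fun x => (x - a) * (b - x))).
by apply: cvgM; apply: cvgB; (exact: cvg_cst || exact: cvg_id).
Qed.

Lemma semicircle_gt0 x : x \in `]a, b[ -> 0 < h x.
Proof. by rewrite in_itv /= => /andP[ax xb]; rewrite sqrtr_gt0 mulr_gt0 ?subr_gt0. Qed.

Lemma semicircle_sqr x : x \in `[a, b] -> h x ^+ 2 = (x - a) * (b - x).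
Proof. by rewrite in_itv /= => /andP[ax xb]; rewrite sqr_sqrtr // mulr_ge0 ?subr_ge0. Qed.

Lemma semicircle_bnd : h a = 0 /\ h b = 0.
Proof. by rewrite /semicircle !subrr mul0r mulr0 sqrtr0. Qed.

Lemma is_derive_semicircle x : x \in `]a, b[ ->
  is_derive x 1 h ((a + b - 2 * x) / (2 * h x)).
Proof.
move=> xab; have d1 := is_deriveB (is_derive_id x 1) (is_derive_cst a x 1).
have d2 := is_deriveB (is_derive_cst b x 1) (is_derive_id x 1).
have g0 : 0 < (x - a) * (b - x).
  by move: xab; rewrite in_itv /= => /andP[ax xb]; rewrite mulr_gt0 ?subr_gt0.
apply: (is_derive_eq (@is_derive_sqrt _ (fun x => (x - a) * (b - x)) x _ g0 (is_deriveM d1 d2))).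
rewrite -[semicircle a b x]/(Num.sqrt _); congr (_ / _).
transitivity ((x - a) * (0 - 1) + (b - x) * (1 - 0)); first by [].
ring.
Qed.

Definition semicircle_arc x := half_arc ((x - a) / (b - a)).

Lemma semicircle_arc_bnd : semicircle_arc a = 0 /\ semicircle_arc b = pi / 2.
Proof.
have ba : b - a != 0 by rewrite subr_eq0 gt_eqF.
by rewrite /semicircle_arc subrr mul0r half_arc0 divff // half_arc1.
Qed.

Lemma semicircle_arc_continuous x : {for x, continuous semicircle_arc}.
Proof.
apply: continuous_comp; last exact: half_arc_continuous.
by apply: cvgM; [apply: cvgB; (exact: cvg_cst || exact: cvg_id)|exact: cvg_cst].
Qed.

Lemma is_derive_semicircle_arc x : x \in `]a, b[ ->
  is_derive x 1 semicircle_arc (2 * h x)^-1.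
Proof.
move=> xab; have hx := semicircle_gt0 xab.
have h2 := semicircle_sqr (subset_itv_oo_cc xab).
have ba0 : 0 < b - a by rewrite subr_gt0.
have ba : b - a != 0 by rewrite gt_eqF.
have d1 := is_deriveB (is_derive_id x 1) (is_derive_cst a x 1).
have d2 := is_deriveM d1 (is_derive_cst (b - a)^-1 x 1).
have := @is_derive_half_arc_comp (fun x => (x - a) / (b - a)) x _ (h x / (b - a)) _ _ _ d2.
move=> /(_ _ _ _)/wrap[].
- by rewrite divr_gt0.
- move: xab; rewrite in_itv /= => /andP[ax xb].
  by rewrite divr_gt0 ?subr_gt0 // ltr_pdivrMr // mul1r ltrD2r xb.
- by rewrite expr_div_n h2; field.
move=> d; apply: (is_derive_eq d).
transitivity (((x - a) * 0 + (b - a)^-1 * (1 - 0)) / (2 * (h x / (b - a)))); first by [].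
by field; rewrite ba gt_eqF.
Qed.

Lemma is_derive_pow x k : is_derive x 1 (fun y : R => y ^+ k) (k%:R * x ^+ k.-1).
Proof.
have := is_deriveX k (is_derive_id x 1); rewrite exprfctE => d.
by apply: (is_derive_eq d); rewrite -[LHS]/(_ * 1) mulr1.
Qed.

Lemma pow_continuous x k : {for x, continuous (fun y : R => y ^+ k)}.
Proof. exact: exprn_continuous. Qed.

(** The area of a half-disc of diameter [b - a]. The primitive is the classical one, an arcsine term
    plus a linear factor times [h]. *)
Lemma integral_semicircle :
  mu.-integrable `]a, b[ (EFin \o h) /\
  (\int[mu]_(x in `]a, b[) (h x)%:E = (pi * (b - a) ^+ 2 / 8)%:E)%E.
Proof.
pose F x := ((x - (a + b) / 2) / 2) * h x + (b - a) ^+ 2 / 4 * semicircle_arc x.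
have [ha hb] := semicircle_bnd; have [Aa Ab] := semicircle_arc_bnd.
have -> : pi * (b - a) ^+ 2 / 8 = F b - F a by rewrite /F ha hb Aa Ab; field.
apply: (@FTC_continuous _ h F a b ab).
- by move=> x _; apply: semicircle_continuous.
- move=> x _; apply: cvgD; apply: cvgM; [|exact: semicircle_continuous|exact: cvg_cst|exact: semicircle_arc_continuous].
  by apply: cvgM; [apply: cvgB; [exact: cvg_id|exact: cvg_cst]|exact: cvg_cst].
move=> x xab; have hx : h x != 0 by rewrite gt_eqF // semicircle_gt0.
have h2 := semicircle_sqr (subset_itv_oo_cc xab).
have d1 := is_deriveB (is_derive_id x 1) (is_derive_cst ((a + b) / 2) x 1).
have d2 := is_deriveM d1 (is_derive_cst (2 : R)^-1 x 1).
have d3 := is_deriveM d2 (is_derive_semicircle xab).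
have d4 := is_deriveZ ((b - a) ^+ 2 / 4) (is_derive_semicircle_arc xab).
apply: (is_derive_eq (is_deriveD d3 d4)).
transitivity ((x - (a + b) / 2) / 2 * ((a + b - 2 * x) / (2 * h x)) +
  h x * ((x - (a + b) / 2) * 0 + 2^-1 * (1 - 0)) + (b - a) ^+ 2 / 4 * (2 * h x)^-1); first by [].
transitivity ((h x ^+ 2 + (x - a) * (b - x)) / (2 * h x)); first by field.
by rewrite -h2; field.
Qed.

Lemma integrable_pow_semicircle k :
  mu.-integrable `]a, b[ (EFin \o (fun x => x ^+ k * h x)).
Proof.
have : {within `[a, b], continuous (fun x => x ^+ k * h x)}.
  apply: continuous_in_subspaceT => x _.
  by apply: cvgM; [exact: pow_continuous|exact: semicircle_continuous].
move=> /(continuous_compact_integrable (@segment_compact _ a b)) int_h.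
by apply: integrableS int_h => //; apply: subset_itvW.
Qed.

Definition semicircle_moment k := (\int[mu]_(x in `]a, b[) (x ^+ k * h x))%R.

Lemma semicircle_moment0 : semicircle_moment 0 = pi * (b - a) ^+ 2 / 8.
Proof.
rewrite /semicircle_moment /Rintegral.
under eq_integral do rewrite expr0 mul1r.
by rewrite integral_semicircle.2.
Qed.

(* Integrate the derivative of [x ^+ k * semicircle a b x ^+ 3]. *)
Lemma semicircle_moment_rec k : k.+3%:R * semicircle_moment k.+1 =
  (k%:R + 3 / 2) * (a + b) * semicircle_moment k -
  k%:R * (a * b) * semicircle_moment k.-1.
Proof.
pose f x := (k%:R * x ^+ k.-1) * h x ^+ 3 + x ^+ k * (3 / 2 * (a + b - 2 * x) * h x).
pose F x := x ^+ k * h x ^+ 3.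
have [ha hb] := semicircle_bnd.
have ch3 x : {for x, continuous (fun x => h x ^+ 3)}.
  apply: (@continuous_comp _ _ _ h (fun y => y ^+ 3)); first exact: semicircle_continuous.
  exact: pow_continuous.
have [||| _] := @FTC_continuous _ f F a b ab.
- move=> x _; apply: cvgD; apply: cvgM.
  + by apply: cvgM; [exact: cvg_cst|exact: pow_continuous].
  + exact: ch3.
  + exact: pow_continuous.
  + apply: cvgM; last exact: semicircle_continuous.
    apply: cvgM; first exact: cvg_cst.
    by apply: cvgB; [exact: cvg_cst|apply: cvgM; [exact: cvg_cst|exact: cvg_id]].
- by move=> x _; apply: cvgM; [exact: pow_continuous|exact: ch3].
- move=> x xab; have hx : h x != 0 by rewrite gt_eqF // semicircle_gt0.
  have := is_deriveX 3 (is_derive_semicircle xab); rewrite exprfctE => d3.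
  apply: (is_derive_eq (is_deriveM (is_derive_pow x k) d3)).
  transitivity (x ^+ k * (3%:R * h x ^+ 2 * ((a + b - 2 * x) / (2 * h x))) +
    h x ^+ 3 * (k%:R * x ^+ k.-1)).
    by [].
  by rewrite /f; field.
rewrite /F ha hb expr0n /= !mulr0 subrr => int0.
have fE x : x \in `]a, b[%classic -> f x = (- k.+3%:R) * (x ^+ k.+1 * h x) +
    ((k%:R + 3 / 2) * (a + b) * (x ^+ k * h x) + (- (k%:R * (a * b))) * (x ^+ k.-1 * h x)).
  rewrite inE /= => xab; have h2 := semicircle_sqr (subset_itv_oo_cc xab).
  rewrite /f [h x ^+ 3]exprS h2.
  by case: (k) => [|j] /=; rewrite ?[x ^+ _.+1]exprS; field.
have iZ c j : mu.-integrable `]a, b[ (EFin \o (fun x => c * (x ^+ j * h x))).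
  by apply: eq_integrable (integrableZl _ c (integrable_pow_semicircle j)).
have : (\int[mu]_(x in `]a, b[) f x)%R = 0 by rewrite /Rintegral int0.
have -> := eq_Rintegral mu fE.
rewrite RintegralD //; last first.
  by apply: eq_integrable (integrableD _ (iZ _ _) (iZ _ _)).
rewrite RintegralD // !RintegralZl //; try exact: integrable_pow_semicircle.
by rewrite -!/(semicircle_moment _) => e; apply/eqP; rewrite -subr_eq0 -oppr_eq0 -e; apply/eqP; ring.
Qed.

End Interval.
End SemicircleMoments.

Section SemicircleCauchy.
Context {R : realType}.
Local Notation mu := (@lebesgue_measure R).
Variables a b : R.
Hypothesis ab : a < b.
Local Notation h := (semicircle a b).

(* [eps] is the sign of [x - c] on the interval, so that the two sides of the
   interval are treated at once. *)
Lemma integral_semicircle_div_out (eps c : R) : eps ^+ 2 = 1 ->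
  0 < eps * (a - c) -> 0 < eps * (b - c) ->
  (\int[mu]_(x in `]a, b[) (h x / (eps * (x - c)))%:E =
   (pi * (eps * ((a + b) / 2 - c) - Num.sqrt ((a - c) * (b - c))))%:E)%E.
Proof.
move=> eps2 ac bc.
have ba0 : 0 < b - a by rewrite subr_gt0.
have ba : b - a != 0 by rewrite gt_eqF.
have eps_neq0 : eps != 0 by rewrite -sqrf_eq0 eps2 oner_eq0.
have acbc : 0 < (a - c) * (b - c).
  by have := mulr_gt0 ac bc; rewrite mulrACA -expr2 eps2 mul1r.
have pos x : x \in `[a, b] -> 0 < eps * (x - c).
  rewrite in_itv /= => /andP[ax xb].
  have [e|e|e] := ltrgtP 0 eps.
  - by apply: lt_le_trans ac _; rewrite ler_pM2l // lerD2r.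
  - by apply: lt_le_trans bc _; rewrite ler_nM2l // lerD2r.
  - by rewrite -e mul0r ltxx in ac.
have xc0 x : x \in `[a, b] -> x - c != 0.
  by move=> /pos; apply: contraTneq => ->; rewrite mulr0 ltxx.
have aab : a \in `[a, b] by rewrite in_itv /= lexx ltW.
have bab : b \in `[a, b] by rewrite in_itv /= lexx ltW.
set r := Num.sqrt ((a - c) * (b - c)).
have r0 : 0 < r by rewrite sqrtr_gt0.
have r2 : r ^+ 2 = (a - c) * (b - c) by rewrite sqr_sqrtr // ltW.
(* The Möbius map sending a, b, c to 0, 1 and infinity. The derivative of [half_arc \o q] is a
   constant multiple of 1 / ((x - c) h x), which supplies the pole at c. *)
pose q x := (b - c) * (x - a) / ((x - c) * (b - a)).
pose F x := eps * h x + eps * (a + b - 2 * c) * semicircle_arc a b x - 2 * r * half_arc (q x).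
have [ha hb] := semicircle_bnd a b; have [Aa Ab] := semicircle_arc_bnd ab.
have qa : half_arc (q a) = 0 by rewrite /q subrr mulr0 mul0r half_arc0.
have qb : half_arc (q b) = pi / 2.
  by rewrite /q divff ?half_arc1 // mulf_neq0 // xc0.
have -> : pi * (eps * ((a + b) / 2 - c) - r) = F b - F a.
  by rewrite /F ha hb Aa Ab qa qb; field.
have clin x k : {for x, continuous (fun x : R => x - k)}.
  by apply: cvgB; [exact: cvg_id|exact: cvg_cst].
have cq x : x \in `[a, b] -> {for x, continuous q}.
  move=> xab; apply: cvgM.
    by apply: cvgM; [exact: cvg_cst|exact: clin].
  apply: cvgV; first by rewrite mulf_neq0 // xc0.
  by apply: cvgM; [exact: clin|exact: cvg_cst].
have [] // := @FTC_continuous _ (fun x => h x / (eps * (x - c))) F a b ab.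
- move=> x xab; apply: cvgM; first exact: semicircle_continuous.
  apply: cvgV; first by rewrite gt_eqF // pos.
  by apply: cvgM; [exact: cvg_cst|exact: clin].
- move=> x xab; apply: cvgB.
    apply: cvgD; (apply: cvgM; first exact: cvg_cst).
      exact: semicircle_continuous.
    exact: semicircle_arc_continuous.
  apply: cvgM; first exact: cvg_cst.
  exact: (@continuous_comp _ _ _ q (@half_arc R) x (cq x xab) (@half_arc_continuous _ (q x))).
move=> x xab; have xab' := subset_itv_oo_cc xab.
have hx0 := semicircle_gt0 xab; have xc_gt0 := pos x xab'.
have hx : h x != 0 by rewrite gt_eqF.
have h2 := semicircle_sqr xab'.
have xc := xc0 x xab'.
have d1 := is_deriveB (is_derive_id x 1) (is_derive_cst a x 1).
have d2 := is_deriveZ (b - c) d1.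
have d3 := is_deriveB (is_derive_id x 1) (is_derive_cst c x 1).
have d4 := is_deriveM d3 (is_derive_cst (b - a) x 1).
have xcba : (x - c) * (b - a) != 0 by rewrite mulf_neq0.
have d5 := @is_deriveV _ (fun x => (x - c) * (b - a)) x _ _ xcba d4.
have d6 := is_deriveM d2 d5.
have qE : q x = (eps * (b - c)) * (x - a) / ((eps * (x - c)) * (b - a)).
  by rewrite /q; field; rewrite ba eps_neq0 xc.
have q'E : 1 - q x = (eps * (a - c)) * (b - x) / ((eps * (x - c)) * (b - a)).
  by rewrite /q; field; rewrite ba eps_neq0 xc.
have [xa0 bx0] : 0 < x - a /\ 0 < b - x.
  by move: xab; rewrite in_itv /= !subr_gt0 => /andP[].
have [] := @is_derive_half_arc_comp _ q x _ (r * h x / (eps * (x - c) * (b - a))) _ _ _ d6.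
- exact: divr_gt0 (mulr_gt0 r0 hx0) (mulr_gt0 xc_gt0 ba0).
- apply/andP; split; last rewrite -subr_gt0 q'E.
    by rewrite qE; exact: divr_gt0 (mulr_gt0 bc xa0) (mulr_gt0 xc_gt0 ba0).
  exact: divr_gt0 (mulr_gt0 ac bx0) (mulr_gt0 xc_gt0 ba0).
- rewrite q'E qE expr_div_n !exprMn r2 h2 eps2.
  by field; rewrite ba eps_neq0 xc.
move=> d7v d7e.
have d7 := DeriveDef d7v d7e.
have d8 := is_deriveZ eps (is_derive_semicircle xab).
have d9 := is_deriveZ (eps * (a + b - 2 * c)) (is_derive_semicircle_arc ab xab).
have d10 := is_deriveZ (2 * r) d7.
apply: (is_derive_eq (is_deriveB (is_deriveD d8 d9) d10)).
transitivity (eps * ((a + b - 2 * x) / (2 * h x)) +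
  eps * (a + b - 2 * c) * (2 * h x)^-1 -
  2 * r * (((b - c) * (x - a) * (- ((x - c) * (b - a)) ^- 2 * ((x - c) * 0 + (b - a) * (1 - 0))) +
    ((x - c) * (b - a))^-1 * ((b - c) * (1 - 0))) / (2 * (r * h x / (eps * (x - c) * (b - a)))))).
  by [].
have r_neq0 : r != 0 by rewrite gt_eqF.
transitivity (eps * ((x - a) * (b - x)) / ((x - c) * h x)).
  field; rewrite ?ba ?hx ?eps_neq0 ?xc ?r_neq0 //.
rewrite -h2 -[RHS]mul1r -eps2.
by field; rewrite ?hx ?eps_neq0 ?xc.
Qed.

(** Here c may be an endpoint, as happens at 0 or 1 for the laws below when a parameter equals 1.
    The pole is pushed outside by 1 / (n + 1); the integrands then increase with n, and monotone
    convergence applies. *)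
Lemma integral_semicircle_div (eps c : R) : eps ^+ 2 = 1 ->
  0 <= eps * (a - c) -> 0 <= eps * (b - c) ->
  (\int[mu]_(x in `]a, b[) (h x / (eps * (x - c)))%:E =
   (pi * (eps * ((a + b) / 2 - c) - Num.sqrt ((a - c) * (b - c))))%:E)%E.
Proof.
move=> eps2 ac bc.
pose g (n : nat) (x : R) : \bar R := (h x / (eps * (x - c) + n.+1%:R^-1))%:E.
have eps_neq0 : eps != 0 by rewrite -sqrf_eq0 eps2 oner_eq0.
have nV0 n : 0 < n.+1%:R^-1 :> R by rewrite invr_gt0 ltr0n.
have pos x : x \in `]a, b[ -> 0 < eps * (x - c).
  rewrite in_itv /= => /andP[ax xb].
  have [e|e|e] := ltrgtP 0 eps.
  - by apply: le_lt_trans ac _; rewrite ltr_pM2l // ltrD2r.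
  - by apply: le_lt_trans bc _; rewrite ltr_nM2l // ltrD2r.
  - by rewrite -e eqxx in eps_neq0.
have gE n x : g n x = (h x / (eps * (x - (c - eps / n.+1%:R))))%:E.
  congr (_ / _)%:E; rewrite -{1}[n.+1%:R^-1]mul1r -eps2; ring.
have int_g n : (\int[mu]_(x in `]a, b[) g n x =
    (pi * (eps * ((a + b) / 2 - (c - eps / n.+1%:R)) -
     Num.sqrt ((a - (c - eps / n.+1%:R)) * (b - (c - eps / n.+1%:R)))))%:E)%E.
  under eq_integral do rewrite gE.
  have E x : eps * (x - (c - eps / n.+1%:R)) = eps * (x - c) + n.+1%:R^-1.
    by rewrite -[in RHS](mul1r n.+1%:R^-1) -eps2; ring.
  by apply: integral_semicircle_div_out => //; rewrite E ltr_wpDl.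
have mg n : measurable_fun (`]a, b[ : set R) (g n).
  apply/measurable_EFinP; apply: open_continuous_measurable_fun; first exact: interval_open.
  move=> x; rewrite inE /= => /pos xc; apply: cvgM; first exact: semicircle_continuous.
  apply: cvgV; first by rewrite gt_eqF // addr_gt0.
  apply: cvgD; last exact: cvg_cst.
  by apply: cvgM; [exact: cvg_cst|apply: cvgB; [exact: cvg_id|exact: cvg_cst]].
have g0 n x : `]a, b[%classic x -> (0 <= g n x)%E.
  by move=> /= /pos xc; rewrite lee_fin divr_ge0 ?sqrtr_ge0 // ltW // addr_gt0.
have g_nd x : `]a, b[%classic x -> {homo g^~ x : n m / (n <= m)%N >-> (n <= m)%E}.
  move=> /= /pos xc n m nm; rewrite lee_fin ler_wpM2l ?sqrtr_ge0 //.
  rewrite lef_pV2 ?posrE ?addr_gt0 // lerD2l lef_pV2 ?posrE ?ltr0n //.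
  by rewrite ler_nat.
have h1 := cvg_monotone_convergence (mu := mu) (measurable_itv `]a, b[) mg g0 g_nd.
have <- : (\int[mu]_(x in `]a, b[) (limn (g^~ x)) =
    \int[mu]_(x in `]a, b[) (h x / (eps * (x - c)))%:E)%E.
  apply: eq_integral => x; rewrite inE /= => /pos xc.
  apply/cvg_lim => //; apply: cvg_EFin; first by near=> n.
  apply: cvgM; first exact: cvg_cst.
  apply: cvgV; first by rewrite gt_eqF.
  rewrite -[X in _ --> X]addr0; apply: cvgD; first exact: cvg_cst.
  exact: cvg_harmonic.
rewrite -(cvg_lim _ h1) //; apply/cvg_lim => //.
under eq_fun do rewrite int_g.
apply: cvg_EFin; first by near=> n.
have hc : c - eps / n.+1%:R @[n --> \oo] --> c.
  rewrite -[X in _ --> X]subr0; apply: cvgB; first exact: cvg_cst.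
  rewrite -(mulr0 eps); apply: cvgM; first exact: cvg_cst.
  exact: cvg_harmonic.
apply: cvgM; first exact: cvg_cst.
apply: cvgB.
  apply: cvgM; first exact: cvg_cst.
  by apply: cvgB; first exact: cvg_cst.
apply: continuous_cvg; first exact: sqrt_continuous.
by apply: cvgM; (apply: cvgB; first exact: cvg_cst).
Unshelve. all: by end_near.
Qed.

End SemicircleCauchy.

(** * The free Poisson and free binomial laws *)

Section DensityMeasure.
Local Open Scope ereal_scope.
Context d (T : measurableType d) (R : realType) (m : {measure set T -> \bar R}).
Context (f : T -> \bar R) (mf : measurable_fun setT f) (f0 : forall x, 0 <= f x).

(* The proofs are arguments so that the canonical measure structure can be
   inferred from the term [density_measure m mf f0]. *)
Definition density_measure_of (_ : measurable_fun setT f) (_ : forall x, 0 <= f x)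
  (A : set T) : \bar R := \int[m]_(x in A) f x.
Local Notation density_measure := (density_measure_of mf f0).

Let density0 : density_measure set0 = 0.
Proof. exact: integral_set0. Qed.

Let density_ge0 A : 0 <= density_measure A.
Proof. by apply: integral_ge0 => x _; apply: f0. Qed.

Let density_sigma_additive : semi_sigma_additive density_measure.
Proof.
move=> F mF tF mUF; rewrite /density_measure_of; apply: cvg_toP.
  apply: ereal_nondecreasing_is_cvgn => j k jk.
  by apply: lee_sum_nneg_natr => // i _ _; apply: integral_ge0 => x _; apply: f0.
by rewrite ge0_integral_bigcup //; exact: measurable_funTS.
Qed.

HB.instance Definition _ := isMeasure.Build _ _ _ density_measure
  density0 density_ge0 density_sigma_additive.

Import HBNNSimple.

Let integral_density_nnsfun (g : {nnsfun T >-> R}) :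
  \int[density_measure]_x (g x)%:E = \int[m]_x ((g x)%:E * f x).
Proof.
under [LHS]eq_integral do rewrite fimfunE -fsumEFin//.
rewrite [LHS]ge0_integral_fsum//; last 2 first.
  - by move=> r; exact/measurable_EFinP/measurableT_comp.
  - by move=> n x _; rewrite EFinM nnfun_muleindic_ge0.
have gE x : (g x)%:E * f x = \sum_(y \in range g) (y * \1_(g @^-1` [set y]) x)%:E * f x.
  rewrite fimfunE -fsumEFin// ge0_mule_fsuml // => r.
  by rewrite EFinM nnfun_muleindic_ge0.
under [RHS]eq_integral do rewrite gE.
rewrite [RHS]ge0_integral_fsum//; last 2 first.
  - by move=> r; apply: emeasurable_funM => //; apply/measurable_EFinP/measurableT_comp.
  - by move=> n x _; rewrite mule_ge0 //; rewrite EFinM nnfun_muleindic_ge0.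
apply: eq_fsbigr => r _.
rewrite integralZl_indic_nnsfun //= integral_indic // setIT.
have [r0|r0] := ltP r 0%R.
  rewrite preimage_nnfun0 // measure0 mule0.
  by rewrite integral0_eq // => x _; rewrite indic0 mulr0 mul0e.
rewrite /density_measure_of -ge0_integralZl //; last exact: measurable_funTS.
rewrite [LHS]integral_mkcond; apply: eq_integral => x _.
rewrite patchE indicE; case: ifPn => _; first by rewrite mulr1.
by rewrite mulr0 mul0e.
Qed.

Lemma ge0_integral_density (g : T -> \bar R) : measurable_fun setT g ->
  (forall x, 0 <= g x) -> (forall x, f x \is a fin_num) ->
  \int[density_measure]_x g x = \int[m]_x (g x * f x).
Proof.
move=> mg g0 f_fin; pose g_ := nnsfun_approx measurableT mg.
have g_nd x : {homo (fun n => (g_ n x)%:E) : j k / (j <= k)%N >-> j <= k}.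
  by move=> j k jk; rewrite lee_fin; exact/lefP/nd_nnsfun_approx.
have mg_ n : measurable_fun setT (fun x => (g_ n x)%:E).
  exact/measurable_EFinP/measurable_funTS.
have gE x : limn (fun n => (g_ n x)%:E) = g x.
  by apply/cvg_lim => //; apply: cvg_nnsfun_approx.
transitivity (limn (fun n => \int[density_measure]_x (g_ n x)%:E)).
  rewrite -monotone_convergence //.
    by apply: eq_integral => x _; rewrite gE.
  by move=> n x _; rewrite lee_fin.
under eq_fun do rewrite integral_density_nnsfun.
rewrite -monotone_convergence //.
- apply: eq_integral => x _; rewrite -gE.
  have cg : cvgn (fun n => (g_ n x)%:E) by apply: ereal_nondecreasing_is_cvgn.
  exact: limeMr.
- by move=> n; apply: emeasurable_funM.
- by move=> n x _; rewrite mule_ge0 // lee_fin.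
- by move=> x _ j k jk; rewrite lee_wpmul2r // g_nd.
Qed.

End DensityMeasure.

Section ProbabilityOfMeasure.
Context d (T : measurableType d) (R : realType) (M : {measure set T -> \bar R}).
Hypothesis M1 : M setT = 1%E.

Definition probability_of (_ : M setT = 1%E) (A : set T) : \bar R := M A.

HB.instance Definition _ := isMeasure.Build _ _ _ (probability_of M1)
  (measure0 M) (measure_ge0 M) (measure_semi_sigma_additive (s := M)).
HB.instance Definition _ :=
  Measure_isProbability.Build _ _ _ (probability_of M1) M1.
End ProbabilityOfMeasure.

Section AtomicLaw.
Context {R : realType}.
Local Notation mu := (@lebesgue_measure R).

(** Both laws have this shape, and their set functions must be shown to come from a probability
    measure. The integral formula asks for positivity of [g] only where the law can charge, because
    odd powers are negative on part of the line. *)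
Lemma atomic_law_exists (a b : R) (f : R -> R) (w0 w1 : R) :
  0 <= w0 -> 0 <= w1 -> measurable_fun `]a, b[ f ->
  (forall x, x \in `]a, b[ -> 0 <= f x) ->
  (w0%:E + \int[mu]_(x in `]a, b[) (f x)%:E + w1%:E = 1)%E ->
  exists2 P : probability (measurableTypeR R) R,
    (forall D : set (measurableTypeR R), measurable D ->
      P D = (w0%:E * dirac (0%R : R) D + \int[mu]_(x in D `&` `]a, b[) (f x)%:E +
             w1%:E * dirac (1%R : R) D)%E) &
    (forall g : R -> R, measurable_fun setT g ->
      (forall x, x \in `]a, b[ -> 0 <= g x) -> 0 <= g 0 -> 0 <= g 1 ->
      (\int[P]_x (g x)%:E = (w0 * g 0)%:E +
        \int[mu]_(x in `]a, b[) (g x * f x)%:E + (w1 * g 1)%:E)%E).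
Proof.
move=> w0_ge0 w1_ge0 mf f_ge0 total.
pose f' (x : R) : \bar R := ((f \_ `]a, b[) x)%:E.
have f'E (x : R) : f' x = if x \in `]a, b[%classic then (f x)%:E else 0%E.
  by rewrite /f' patchE; case: ifP.
have mf' : measurable_fun (setT : set R) f'.
  by apply/measurable_EFinP; apply/(measurable_restrictT _ _).1.
have f'_ge0 (x : R) : (0 <= f' x)%E.
  by rewrite f'E; case: ifP => //; rewrite inE /= => /f_ge0; rewrite lee_fin.
pose M := measure_add (measure_add (mscale (NngNum w0_ge0) (\d_(0 : measurableTypeR R)))
   (density_measure_of mu mf' f'_ge0)) (mscale (NngNum w1_ge0) (\d_(1 : measurableTypeR R))).
have M_ge0 (G : R -> \bar R) : measurable_fun (setT : set R) G -> (forall x, 0 <= G x)%E ->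
    (\int[M]_x G x = w0%:E * G 0%R + \int[mu]_x (G x * f' x) + w1%:E * G 1%R)%E.
  move=> mG G0; rewrite ge0_integral_measure_add //= ge0_integral_measure_add //=.
  rewrite !ge0_integral_mscale //= !integral_dirac //= !diracT !mul1e.
  by rewrite ge0_integral_density.
have f'_int (D : set R) (G : R -> \bar R) : measurable D ->
    (\int[mu]_(x in D) (G x * f' x) = \int[mu]_(x in D `&` `]a, b[) (G x * (f x)%:E))%E.
  move=> mD; rewrite [RHS]integral_mkcondr; apply: eq_integral => x _.
  by rewrite f'E patchE; case: ifP => _ //; rewrite mule0.
have ME (D : set (measurableTypeR R)) : measurable D ->
    (M D = w0%:E * dirac (0%R : R) D + \int[mu]_(x in D `&` `]a, b[) (f x)%:E +
     w1%:E * dirac (1%R : R) D)%E.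
  move=> mD; rewrite /M measure_addE; congr (_ + _)%E.
  rewrite [LHS]measure_addE; congr (_ + _)%E.
  transitivity (\int[mu]_(x in D) (1 * f' x))%E.
    by apply: eq_integral => x _; rewrite mul1e.
  by rewrite (f'_int D (fun=> 1%E)) //; apply: eq_integral => x _; rewrite mul1e.
have MT : M setT = 1%E.
  by rewrite ME // setTI !diracT !mule1.
pose P : probability (measurableTypeR R) R := probability_of MT.
exists P => // g mg g_ge0 g0 g1.
have mgE : measurable_fun (setT : set R) (EFin \o g) by exact/measurable_EFinP.
rewrite integralE.
rewrite (M_ge0 (EFin \o g)^\+%E); [|exact: measurable_funepos|by []].
rewrite (M_ge0 (EFin \o g)^\-%E); [|exact: measurable_funeneg|by []].
have posE x : 0 <= g x -> ((EFin \o g)^\+ x = (g x)%:E /\ (EFin \o g)^\- x = 0)%E.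
  move=> gx; rewrite funeposE funenegE /=.
  by split; [apply/max_idPl|apply/max_idPr]; rewrite ?lee_fin ?oppr_le0.
rewrite !f'_int // !setTI !(posE _ g0).1 !(posE _ g0).2 !(posE _ g1).1 !(posE _ g1).2 !mule0.
rewrite [X in (_ - (0 + X + 0))%E]integral0_eq; last first.
  by move=> x /= /g_ge0 /posE[_ ->]; rewrite mul0e.
rewrite !adde0 sube0; congr (_ + _ + _)%E.
by apply: eq_integral => x; rewrite inE /= => /g_ge0 /posE[-> _].
Qed.

End AtomicLaw.

Section FreeLawMoments.
Context {R : realType}.
Local Notation mu := (@lebesgue_measure R).

Lemma ge0_integrableP (a b : R) (f : R -> R) (v : R) :
  measurable_fun `]a, b[ f -> (forall x, x \in `]a, b[ -> 0 <= f x) ->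
  (\int[mu]_(x in `]a, b[) (f x)%:E = v%:E)%E -> mu.-integrable `]a, b[ (EFin \o f).
Proof.
move=> mf f0 fv; apply/integrableP; split; first exact/measurable_EFinP.
apply: (@le_lt_trans _ _ v%:E); last exact: ltry.
rewrite -fv le_eqVlt; apply/orP; left; apply/eqP/eq_integral => x.
by rewrite inE /= => /f0 fx; rewrite ger0_norm.
Qed.

Lemma integral_pow_semicircle (a b : R) k :
  (\int[mu]_(x in `]a, b[) (x ^+ k * semicircle a b x)%:E = (semicircle_moment a b k)%:E)%E.
Proof.
by rewrite /semicircle_moment /Rintegral fineK // integrable_fin_num // integrable_pow_semicircle.
Qed.

Lemma measurable_fun_oo (a b : R) (f : R -> R) :
  {in `]a, b[, forall x, {for x, continuous f}} -> measurable_fun `]a, b[ f.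
Proof.
move=> cf; apply: open_continuous_measurable_fun; first exact: interval_open.
by move=> x; rewrite inE => /cf.
Qed.

Lemma atomic_law_moment (a b w0 w1 : R) (f : R -> R) (P : probability (measurableTypeR R) R)
    (g : R -> R) (v : R) :
  (forall g : R -> R, measurable_fun setT g ->
      (forall x, x \in `]a, b[ -> 0 <= g x) -> 0 <= g 0 -> 0 <= g 1 ->
      (\int[P]_x (g x)%:E = (w0 * g 0)%:E +
        \int[mu]_(x in `]a, b[) (g x * f x)%:E + (w1 * g 1)%:E)%E) ->
  measurable_fun setT g -> (forall x, x \in `]a, b[ -> 0 <= g x) ->
  0 <= g 0 -> 0 <= g 1 -> (\int[mu]_(x in `]a, b[) (g x * f x)%:E = v%:E)%E ->
  P.-integrable setT (fun x => (g x)%:E) /\ \int[P]_x g x = w0 * g 0 + v + w1 * g 1.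
Proof.
move=> PE mg g_ge0 g0 g1 gv; split; last by rewrite /Rintegral PE // gv.
apply/integrableP; split; first exact/measurable_EFinP.
apply: (@le_lt_trans _ _ (w0 * g 0 + v + w1 * g 1)%:E); last exact: ltry.
have := PE (fun x => `|g x|); rewrite !ger0_norm // => h.
rewrite (_ : (\int[P]_x _ = \int[P]_x `|g x|%:E)%E) // h //.
- rewrite !EFinD -gv le_eqVlt; apply/orP; left; apply/eqP; congr (_ + _ + _)%E.
  by apply: eq_integral => x; rewrite inE /= => /g_ge0 gx; rewrite ger0_norm.
- exact: measurableT_comp.
Qed.

Section FreePoisson.
Variables lambda alpha : R.
Hypotheses (lambda0 : 0 < lambda) (alpha0 : 0 < alpha).
Local Notation a := (alpha * (1 - Num.sqrt lambda) ^+ 2).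
Local Notation b := (alpha * (1 + Num.sqrt lambda) ^+ 2).

Let sqrt_lambda : Num.sqrt lambda ^+ 2 = lambda.
Proof. by rewrite sqr_sqrtr // ltW. Qed.

Lemma free_poisson_itv_sum : a + b = 2 * alpha * (1 + lambda).
Proof. rewrite -[in RHS]sqrt_lambda; ring. Qed.

Lemma free_poisson_itv_prod : a * b = (alpha * (1 - lambda)) ^+ 2.
Proof. rewrite -[in RHS]sqrt_lambda; ring. Qed.

Lemma free_poisson_itv_lt : a < b.
Proof.
rewrite ltr_pM2l // -subr_gt0.
have -> : (1 + Num.sqrt lambda) ^+ 2 - (1 - Num.sqrt lambda) ^+ 2 = 4 * Num.sqrt lambda by ring.
by rewrite mulr_gt0 ?ltr0n // sqrtr_gt0.
Qed.

Lemma free_poisson_itv_ge0 : 0 <= a.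
Proof. by rewrite mulr_ge0 ?sqr_ge0 // ltW. Qed.

Lemma free_poisson_pdfE x : x \in `]a, b[ ->
  free_poisson_pdf lambda alpha x = (2 * pi * alpha)^-1 * (semicircle a b x / x).
Proof.
move=> xab; have x0 : 0 < x.
  by move: xab; rewrite in_itv /= => /andP[ax _]; apply: le_lt_trans free_poisson_itv_ge0 ax.
rewrite /free_poisson_pdf /semicircle.
have -> : (x - a) * (b - x) = 4 * lambda * alpha ^+ 2 - (x - alpha * (1 + lambda)) ^+ 2.
  rewrite -[in RHS]sqrt_lambda; ring.
by rewrite invfM -[LHS]mulrA; congr (_ * _); rewrite mulrC.
Qed.

Lemma free_poisson_mass : (\int[mu]_(x in `]a, b[) (semicircle a b x / x)%:E =
  (pi * (alpha * (1 + lambda) - alpha * `|1 - lambda|))%:E)%E.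
Proof.
have a0 := free_poisson_itv_ge0; have ab := free_poisson_itv_lt.
have := @integral_semicircle_div _ _ _ ab 1 0.
rewrite expr1n !mul1r !subr0 => /(_ erefl a0 (le_trans a0 (ltW ab))).
rewrite free_poisson_itv_sum free_poisson_itv_prod sqrtr_sqr normrM (gtr0_norm alpha0).
have -> : 2 * alpha * (1 + lambda) / 2 = alpha * (1 + lambda) by field.
by move=> <-; apply: eq_integral => x _; rewrite mul1r subr0.
Qed.

Let itv_gt0 x : x \in `]a, b[ -> 0 < x.
Proof.
by rewrite in_itv /= => /andP[ax _]; apply: le_lt_trans free_poisson_itv_ge0 ax.
Qed.

Let msx : measurable_fun `]a, b[ (fun x => semicircle a b x / x).
Proof.
apply: measurable_fun_oo => x xab; apply: cvgM; first exact: semicircle_continuous.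
by apply: cvgV; [rewrite gt_eqF // itv_gt0|exact: cvg_id].
Qed.

Let sx0 x : x \in `]a, b[ -> 0 <= semicircle a b x / x.
Proof. by move=> xab; rewrite divr_ge0 ?sqrtr_ge0 // ltW // itv_gt0. Qed.

Lemma measurable_free_poisson_pdf : measurable_fun `]a, b[ (free_poisson_pdf lambda alpha).
Proof.
apply: (eq_measurable_fun (fun x => (2 * pi * alpha)^-1 * (semicircle a b x / x))).
  by move=> x; rewrite inE => /free_poisson_pdfE ->.
by apply: measurable_funM.
Qed.

Lemma free_poisson_pdf_ge0 x : x \in `]a, b[ -> 0 <= free_poisson_pdf lambda alpha x.
Proof.
move=> xab; rewrite free_poisson_pdfE // mulr_ge0 ?sx0 // invr_ge0.
by rewrite mulr_ge0 ?(ltW alpha0) // mulr_ge0 // pi_ge0.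
Qed.

(** One factor x cancels the 1 / x of the density, so the moment of order r + 1 is a semicircle
    moment of order r; the atom at 0 contributes nothing to it. *)
Lemma free_poisson_law : exists2 P : probability (measurableTypeR R) R,
  (forall D : set (measurableTypeR R), measurable D -> P D = free_poisson lambda alpha D) &
  forall r, P.-integrable setT (fun x => (x ^+ r.+1)%:E) /\
    \int[P]_x (x ^+ r.+1) = semicircle_moment a b r / (2 * pi * alpha).
Proof.
have a0 := free_poisson_itv_ge0; have ab := free_poisson_itv_lt.
have x0 x : x \in `]a, b[ -> 0 < x.
  by rewrite in_itv /= => /andP[ax _]; apply: le_lt_trans ax.
have pi_neq0 : pi != 0 :> R by rewrite gt_eqF // pi_gt0.
have alpha_neq0 : alpha != 0 by rewrite gt_eqF.
have c0 : 0 < 2 * pi * alpha by rewrite !mulr_gt0 // pi_gt0.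
pose w0 := Num.max 0 (1 - lambda).
have w0_ge0 : 0 <= w0 by rewrite le_max lexx.
have mf := measurable_free_poisson_pdf; have f0 := free_poisson_pdf_ge0.
have mass : (\int[mu]_(x in `]a, b[) (free_poisson_pdf lambda alpha x)%:E =
    ((2 * pi * alpha)^-1 * (pi * (alpha * (1 + lambda) - alpha * `|1 - lambda|)))%:E)%E.
  transitivity (\int[mu]_(x in `]a, b[)
    (((2 * pi * alpha)^-1)%:E * (semicircle a b x / x)%:E))%E.
    by apply: eq_integral => x; rewrite inE /= => xab; rewrite free_poisson_pdfE.
  rewrite integralZl //; last exact: ge0_integrableP free_poisson_mass.
  by rewrite free_poisson_mass.
have [|P PE Pg] := @atomic_law_exists R a b _ w0 0 w0_ge0 (lexx 0) mf f0.
  rewrite mass -!EFinD; congr _%:E.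
  (* The density has mass min (1, lambda), the absolute value being the square root of the product
     of the endpoints up to the factor [alpha]. The atom supplies what is missing to 1. *)
  transitivity (w0 + (1 + lambda - `|1 - lambda|) / 2); first by move: (pi) pi_neq0 => p p0; field; rewrite ?alpha_neq0 ?p0.
  rewrite /w0; have [l1|l1] := leP 0 (1 - lambda).
    by rewrite ger0_norm //; field.
  by rewrite ltr0_norm //; field.
exists P => [D mD|r]; first by rewrite PE // mul0e adde0.
have [|||||int_r ->] := @atomic_law_moment a b w0 0 _ P (fun x => x ^+ r.+1)
  (semicircle_moment a b r / (2 * pi * alpha)) Pg.
- exact: exprn_measurable.
- by move=> x /x0 xgt0; rewrite exprn_ge0 // ltW.
- by rewrite exprn_ge0.
- by rewrite exprn_ge0.
- transitivity (\int[mu]_(x in `]a, b[)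
    (((2 * pi * alpha)^-1)%:E * (x ^+ r * semicircle a b x)%:E))%E.
    apply: eq_integral => x; rewrite inE /= => xab; rewrite free_poisson_pdfE //.
    rewrite -EFinM exprS; congr _%:E.
    have x_neq0 : x != 0 by rewrite gt_eqF // x0.
    by move: (pi) pi_neq0 => p p0; field; rewrite ?x_neq0 ?alpha_neq0 ?p0.
  rewrite integralZl //; last exact: integrable_pow_semicircle.
  by rewrite integral_pow_semicircle -EFinM [X in X%:E = _]mulrC.
- by split=> //; rewrite expr0n /= mulr0 add0r mul0r addr0.
Qed.

End FreePoisson.
End FreeLawMoments.

Section FreeBinomialMoments.
Context {R : realType}.
Local Notation mu := (@lebesgue_measure R).
Variables sigma theta : R.
Hypotheses (sigma0 : 0 < sigma) (theta0 : 0 < theta) (st1 : 1 < sigma + theta).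
Local Notation a := (fbinom_left sigma theta).
Local Notation b := (fbinom_right sigma theta).
Local Notation lambda := (sigma + theta).
Local Notation p := (sigma / lambda * (1 - lambda^-1)).
Local Notation q := (lambda^-1 * (1 - sigma / lambda)).

Let lambda0 : 0 < lambda. Proof. exact: addr_gt0. Qed.
Let lambda_neq0 : lambda != 0. Proof. by rewrite gt_eqF. Qed.

Let p0 : 0 < p.
Proof. by rewrite mulr_gt0 ?divr_gt0 // subr_gt0 invf_lt1. Qed.

Let q0 : 0 < q.
Proof. by rewrite mulr_gt0 ?invr_gt0 // subr_gt0 ltr_pdivrMr // mul1r ltrDl. Qed.

Let sqrt_p : Num.sqrt p ^+ 2 = p. Proof. by rewrite sqr_sqrtr // ltW. Qed.
Let sqrt_q : Num.sqrt q ^+ 2 = q. Proof. by rewrite sqr_sqrtr // ltW. Qed.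

Lemma fbinom_itv_sum : a + b = 2 * (lambda + sigma * lambda - 2 * sigma) / lambda ^+ 2.
Proof.
transitivity (2 * (Num.sqrt p ^+ 2 + Num.sqrt q ^+ 2)).
  by rewrite /fbinom_left /fbinom_right; ring.
by rewrite sqrt_p sqrt_q; field.
Qed.

Lemma fbinom_itv_prod : a * b = ((sigma - 1) / lambda) ^+ 2.
Proof.
transitivity ((Num.sqrt p ^+ 2 - Num.sqrt q ^+ 2) ^+ 2).
  by rewrite /fbinom_left /fbinom_right; ring.
by rewrite sqrt_p sqrt_q; field.
Qed.

Lemma fbinom_itv_onem_prod : (a - 1) * (b - 1) = ((theta - 1) / lambda) ^+ 2.
Proof.
transitivity (a * b - (a + b) + 1); first ring.
by rewrite fbinom_itv_sum fbinom_itv_prod; field.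
Qed.

Lemma fbinom_itv_lt : a < b.
Proof.
rewrite -subr_gt0 /fbinom_left /fbinom_right.
set u := Num.sqrt p; set v := Num.sqrt q.
have -> : (u + v) ^+ 2 - (u - v) ^+ 2 = 4 * (u * v) by ring.
by rewrite mulr_gt0 ?ltr0n // mulr_gt0 // sqrtr_gt0.
Qed.

Lemma fbinom_itv_ge0 : 0 <= a. Proof. exact: sqr_ge0. Qed.

(** Since (a - 1) (b - 1) is a square, a and b cannot lie strictly on opposite sides of 1; as their
    sum is less than 2, both are at most 1. *)
Lemma fbinom_itv_le1 : b <= 1.
Proof.
have h : 0 <= (a - 1) * (b - 1) by rewrite fbinom_itv_onem_prod sqr_ge0.
have sum2 : a + b < 2.
  rewrite fbinom_itv_sum ltr_pdivrMr ?exprn_gt0 // ltr_pM2l // -subr_gt0.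
  have -> : lambda ^+ 2 - (lambda + sigma * lambda - 2 * sigma) =
    theta * (lambda - 1) + sigma by ring.
  by rewrite addr_gt0 // mulr_gt0 // subr_gt0.
rewrite leNgt; apply/negP => b1.
have : (a - 1) * (b - 1) < 0.
  by rewrite nmulr_rlt0 ?subr_gt0 // subr_lt0; lra.
by rewrite ltNge h.
Qed.

Let pi_neq0 : pi != 0 :> R. Proof. by rewrite gt_eqF // pi_gt0. Qed.

Let itv_gt0 x : x \in `]a, b[ -> 0 < x.
Proof. by rewrite in_itv /= => /andP[ax _]; apply: le_lt_trans fbinom_itv_ge0 ax. Qed.

Let itv_lt1 x : x \in `]a, b[ -> 0 < 1 - x.
Proof. by rewrite subr_gt0 in_itv /= => /andP[_ xb]; apply: lt_le_trans xb fbinom_itv_le1. Qed.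

Lemma integral_fbinom_left :
  (\int[mu]_(x in `]a, b[) (semicircle a b x / x)%:E =
   (pi * ((lambda + sigma * lambda - 2 * sigma) / lambda ^+ 2 - `|sigma - 1| / lambda))%:E)%E.
Proof.
have a0 := fbinom_itv_ge0; have ab := fbinom_itv_lt.
have := @integral_semicircle_div _ _ _ ab 1 0.
rewrite expr1n !mul1r !subr0 => /(_ erefl a0 (le_trans a0 (ltW ab))).
rewrite fbinom_itv_sum fbinom_itv_prod sqrtr_sqr normrM (gtr0_norm (x := lambda^-1)) ?invr_gt0 //.
set A := _ / lambda ^+ 2; set A' := _ / lambda ^+ 2.
have -> : A / 2 = A' by rewrite /A /A'; field.
by move=> <-; apply: eq_integral => x _; rewrite mul1r subr0.
Qed.

Lemma integral_fbinom_right :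
  (\int[mu]_(x in `]a, b[) (semicircle a b x / (1 - x))%:E =
   (pi * (1 - (lambda + sigma * lambda - 2 * sigma) / lambda ^+ 2 - `|theta - 1| / lambda))%:E)%E.
Proof.
have b1 := fbinom_itv_le1; have ab := fbinom_itv_lt.
have := @integral_semicircle_div _ _ _ ab (-1) 1.
rewrite sqrrN expr1n !mulN1r !oppr_ge0 !subr_le0.
move=> /(_ erefl (le_trans (ltW ab) b1) b1).
rewrite fbinom_itv_sum fbinom_itv_onem_prod sqrtr_sqr normrM (gtr0_norm (x := lambda^-1)) ?invr_gt0 //.
set A := _ / lambda ^+ 2; set A' := _ / lambda ^+ 2.
have -> : - (A / 2 - 1) = 1 - A' by rewrite /A /A'; field.
by move=> <-; apply: eq_integral => x _; rewrite mulN1r opprB.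
Qed.

Let semicircle_div_right :
  measurable_fun `]a, b[ (fun x => semicircle a b x / (1 - x)).
Proof.
apply: measurable_fun_oo => y yab; apply: cvgM; first exact: semicircle_continuous.
apply: cvgV; first by rewrite gt_eqF // itv_lt1.
by apply: cvgB; [exact: cvg_cst|exact: cvg_id].
Qed.

Let semicircle_div_left : measurable_fun `]a, b[ (fun x => semicircle a b x / x).
Proof.
apply: measurable_fun_oo => y yab; apply: cvgM; first exact: semicircle_continuous.
by apply: cvgV; [rewrite gt_eqF // itv_gt0|exact: cvg_id].
Qed.

Let integrable_left : mu.-integrable `]a, b[ (EFin \o (fun x => semicircle a b x / x)).
Proof.
apply: ge0_integrableP integral_fbinom_left => // x xab.
by rewrite divr_ge0 ?sqrtr_ge0 // ltW // itv_gt0.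
Qed.

Let integrable_right : mu.-integrable `]a, b[ (EFin \o (fun x => semicircle a b x / (1 - x))).
Proof.
apply: ge0_integrableP integral_fbinom_right => // x xab.
by rewrite divr_ge0 ?sqrtr_ge0 // ltW // itv_lt1.
Qed.

Local Notation C := (lambda / (2 * pi)).

(** Partial fractions of 1 / (x (1 - x)), which reduce the mass to the two integrals just
    computed. *)
Lemma free_binomial_pdfE x : x \in `]a, b[ -> free_binomial_pdf sigma theta x =
  C * (semicircle a b x / x + semicircle a b x / (1 - x)).
Proof.
move=> xab; have x0 : x != 0 by rewrite gt_eqF // itv_gt0.
have x1 : 1 - x != 0 by rewrite gt_eqF // itv_lt1.
rewrite /free_binomial_pdf -/(semicircle a b x).
by move: (pi) pi_neq0 => P P0; field; rewrite ?x0 ?x1 ?P0.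
Qed.

(** A form without case distinction, whose absolute value cancels the one produced by the integrals
    at 0 and at 1. *)
Lemma atom_weightE (s : R) : 0 < s -> atom_weight s = (1 - s + `|s - 1|) / 2.
Proof.
move=> s0; rewrite /atom_weight s0 /=; case: ltP => s1.
  by rewrite ltr0_norm ?subr_lt0 //; field.
by rewrite ger0_norm ?subr_ge0 //; field.
Qed.

Lemma atom_weight_ge0 (s : R) : 0 <= atom_weight s.
Proof. by rewrite /atom_weight; case: ifP => // /andP[_ s1]; rewrite subr_ge0 ltW. Qed.

(* The singularity at 1 is removed by differences: [x^r (1 - x)] times the
   density is a polynomial multiple of the semicircle. *)
Lemma free_binomial_law : exists2 P : probability (measurableTypeR R) R,
  (forall D : set (measurableTypeR R), measurable D -> P D = free_binomial sigma theta D) &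
  forall u : nat -> R, u 0 = sigma / lambda ->
    (forall r, u r - u r.+1 = C * semicircle_moment a b r) ->
  forall r, P.-integrable setT (fun x => (x ^+ r.+1)%:E) /\ \int[P]_x (x ^+ r.+1) = u r.
Proof.
have a0 := fbinom_itv_ge0; have ab := fbinom_itv_lt.
set f := free_binomial_pdf sigma theta.
have C0 : 0 <= C by rewrite divr_ge0 ?(ltW lambda0) // mulr_ge0 // pi_ge0.
have f0 x : x \in `]a, b[ -> 0 <= f x.
  move=> xab; rewrite /f free_binomial_pdfE // mulr_ge0 // addr_ge0 // divr_ge0 ?sqrtr_ge0 //.
    by rewrite ltW // itv_gt0.
  by rewrite ltW // itv_lt1.
have mf : measurable_fun `]a, b[ f.
  apply: (eq_measurable_fun (fun x => C * (semicircle a b x / x + semicircle a b x / (1 - x)))).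
    by move=> x; rewrite inE => xab; rewrite /f free_binomial_pdfE.
  by apply: measurable_funM => //; apply: measurable_funD.
pose K := (lambda + sigma * lambda - 2 * sigma) / lambda ^+ 2.
have mass : (\int[mu]_(x in `]a, b[) (f x)%:E =
    (C * (pi * (K - `|sigma - 1| / lambda) + pi * (1 - K - `|theta - 1| / lambda)))%:E)%E.
  transitivity (\int[mu]_(x in `]a, b[) (C%:E *
     ((semicircle a b x / x)%:E + (semicircle a b x / (1 - x))%:E)))%E.
    by apply: eq_integral => x; rewrite inE /= => xab; rewrite /f free_binomial_pdfE.
  rewrite integralZl //; last exact: integrableD.
  by rewrite integralD // integral_fbinom_left integral_fbinom_right.
have [|P PE Pg] := @atomic_law_exists R a b f (atom_weight sigma) (atom_weight theta)
  (atom_weight_ge0 _) (atom_weight_ge0 _) mf f0.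
  rewrite mass -!EFinD !atom_weightE //; congr _%:E.
  by move: (pi) pi_neq0 => P P0; field; rewrite ?P0 ?lambda_neq0.
exists P => [D mD|u u0 urec]; first by rewrite PE.
(* The atom at 1 adds its weight to every moment and the atom at 0 adds nothing, so the density must
   account for [u r - atom_weight theta]. *)
have moment r : mu.-integrable `]a, b[ (fun x => (x ^+ r.+1 * f x)%:E) /\
    (\int[mu]_(x in `]a, b[) (x ^+ r.+1 * f x)%:E = (u r - atom_weight theta)%:E)%E.
  elim: r => [|r [int_r Er]].
    have fE : {in `]a, b[%classic, (fun x => C%:E * (semicircle a b x / (1 - x))%:E)%E =1
        (fun x => (x ^+ 1 * f x)%:E)}.
      move=> x; rewrite inE /= => xab; rewrite /f free_binomial_pdfE // -EFinM expr1; congr _%:E.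
      have x0 : x != 0 by rewrite gt_eqF // itv_gt0.
      have x1 : 1 - x != 0 by rewrite gt_eqF // itv_lt1.
      by move: (pi) pi_neq0 => P' P0; field; rewrite ?x0 ?x1 ?P0.
    split; first by apply: (@eq_integrable _ _ _ mu _ (measurable_itv _) _ _ fE); apply: integrableZl.
    rewrite -(@eq_integral _ _ _ mu _ _ _ fE) integralZl // integral_fbinom_right u0 atom_weightE //.
    rewrite -EFinM; congr _%:E.
    by move: (pi) pi_neq0 => P' P0; field; rewrite ?P0 ?lambda_neq0.
  have fE : {in `]a, b[%classic, (fun x => (x ^+ r.+1 * f x)%:E -
      C%:E * (x ^+ r * semicircle a b x)%:E)%E =1 (fun x => (x ^+ r.+2 * f x)%:E)}.
    move=> x; rewrite inE /= => xab; rewrite /f free_binomial_pdfE // -?EFinM -?EFinB !(exprS x); congr _%:E.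
    have x0 : x != 0 by rewrite gt_eqF // itv_gt0.
    have x1 : 1 - x != 0 by rewrite gt_eqF // itv_lt1.
    by move: (pi) pi_neq0 => P' P0; field; rewrite ?x0 ?x1 ?P0.
  have int_s : mu.-integrable `]a, b[ (fun x => C%:E * (x ^+ r * semicircle a b x)%:E)%E.
    by apply: integrableZl => //; exact: integrable_pow_semicircle.
  split; first by apply: (@eq_integrable _ _ _ mu _ (measurable_itv _) _ _ fE); apply: integrableB.
  rewrite -(@eq_integral _ _ _ mu _ _ _ fE) integralB // Er integralZl //; last exact: integrable_pow_semicircle.
  rewrite integral_pow_semicircle -EFinM -EFinB; congr _%:E.
  by rewrite -urec; ring.
move=> r; have [||||int_r ->] := @atomic_law_moment R a b _ _ f P (fun x => x ^+ r.+1) _ Pg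
  _ _ _ _ (moment r).2.
- exact: exprn_measurable.
- by move=> x /itv_gt0 x0; rewrite exprn_ge0 // ltW.
- by rewrite exprn_ge0.
- by rewrite exprn_ge0.
by split=> //; rewrite expr0n expr1n /= mulr0 add0r mulr1 subrK.
Qed.

End FreeBinomialMoments.

(** * Comparison of moments *)

Section MomentComparison.
Context {R : realType}.
Implicit Types (P Q : probability (measurableTypeR R) R) (K : set (measurableTypeR R)).

Lemma Rintegral_le_supported P K (g : R -> R) c : measurable K -> P K = 1%E ->
  P.-integrable setT (EFin \o g) -> (forall x, K x -> g x <= c) ->
  \int[P]_x g x <= c.
Proof.
move=> mK PK int_g gc.
have PKC : P (~` K) = 0%E by rewrite probability_setC // PK subee.
have intK : P.-integrable K (EFin \o g) by apply: integrableS int_g.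
have E : (\int[P]_x (g x)%:E = \int[P]_(x in K) (g x)%:E)%E.
  rewrite (negligible_integral (N := ~` K)) //; last exact: measurableC.
  by rewrite setDE setCK setTI.
rewrite /Rintegral E -lee_fin fineK; last exact: integrable_fin_num.
apply: (@le_trans _ _ (\int[P]_(x in K) c%:E)%E); last by rewrite integral_cst //= PK mule1.
apply: le_integral => //; last by move=> x; rewrite inE => /gc; rewrite lee_fin.
exact: finite_measure_integrable_cst.
Qed.

Lemma Rintegral_ge_supported P K (g : R -> R) c : measurable K -> P K = 1%E ->
  P.-integrable setT (EFin \o g) -> (forall x, K x -> c <= g x) ->
  c <= \int[P]_x g x.
Proof.
move=> mK PK int_g gc.
have int_Ng : P.-integrable setT (EFin \o (fun x => -1 * g x)).
  by apply: eq_integrable (integrableZl _ (-1) int_g).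
have := Rintegral_le_supported (c := - c) mK PK int_Ng.
rewrite RintegralZl // mulN1r lerN2; apply => x Kx.
by rewrite mulN1r lerN2; apply: gc.
Qed.

(** The index is shifted: [m r] is the moment of order r + 1, the moment of order 0 of a probability
    being always 1. *)
Definition has_moments P (m : nat -> R) := forall r,
  P.-integrable setT (fun x => (x ^+ r.+1)%:E) /\ \int[P]_x (x ^+ r.+1) = m r.

Lemma has_moments_horner P (m : nat -> R) (p : {poly R}) : has_moments P m ->
  P.-integrable setT (fun x => (p.[x])%:E) /\
  \int[P]_x p.[x] = p`_0 + \sum_(i < (size p).-1) p`_i.+1 * m i.
Proof.
move=> Pm.
have key n (c : nat -> R) : P.-integrable setT (fun x => (c 0 + \sum_(i < n) c i.+1 * x ^+ i.+1)%:E) /\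
    \int[P]_x (c 0 + \sum_(i < n) c i.+1 * x ^+ i.+1) = c 0 + \sum_(i < n) c i.+1 * m i.
  elim: n => [|n [IH1 IH2]].
    have E : (fun x : R => c 0 + \sum_(i < 0) c i.+1 * x ^+ i.+1) = cst (c 0).
      by apply/funext => x; rewrite big_ord0 addr0.
    rewrite big_ord0 addr0 (_ : (fun x => _%:E) = EFin \o cst (c 0)); last by rewrite -E.
    split; first exact: finite_measure_integrable_cst.
    by rewrite E Rintegral_cst //= probability_setT mulr1.
  have E : (fun x : R => c 0 + \sum_(i < n.+1) c i.+1 * x ^+ i.+1) =
      (fun x => (c 0 + \sum_(i < n) c i.+1 * x ^+ i.+1) + c n.+1 * x ^+ n.+1).
    by apply/funext => x; rewrite big_ord_recr addrA.
  have int_n : P.-integrable setT (EFin \o (fun x => c n.+1 * x ^+ n.+1)).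
    by apply: eq_integrable (integrableZl _ (c n.+1) (Pm n).1).
  split.
    apply: eq_integrable (integrableD _ IH1 int_n) => // x _.
    by rewrite /= (congr1 (fun f => f x) E).
  rewrite E RintegralD // IH2 RintegralZl //; last exact: (Pm n).1.
  by rewrite (Pm n).2 [in RHS]big_ord_recr addrA.
have pE x : p.[x] = p`_0 + \sum_(i < (size p).-1) p`_i.+1 * x ^+ i.+1.
  rewrite horner_coef; case sp: (size p) => [|n] /=.
    by rewrite !big_ord0 nth_default ?sp // addr0.
  by rewrite big_ord_recl expr0 mulr1.
have [k1 k2] := key (size p).-1 (fun i => p`_i).
split; last by under eq_Rintegral do rewrite pE.
by under eq_fun do rewrite pE.
Qed.

(* The polynomials (1 - x / N)^n peak at 0, so the mass near 0 can be read off
   the moments. *)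
Lemma same_moments_null P Q (m : nat -> R) (a b M : R) :
  0 < a -> has_moments P m -> has_moments Q m ->
  P `[a, b]%classic = 1%E -> Q `[0, M]%classic = 1%E -> Q `[0, a / 2]%classic = 0%E.
Proof.
move=> a0 Pm Qm Pab Q0M.
(* With this scale, 1 - x / N lies in [0, 1] on both supports, so its powers are nonnegative and
   decreasing in x there. *)
have [N [N0 aN bN MN]] : exists N : R, [/\ 0 < N, a <= N, b <= N & M <= N].
  exists (`|a| + `|b| + `|M|).
  have := ler_norm a; have := ler_norm b; have := ler_norm M.
  have := normr_ge0 a; have := normr_ge0 b; have := normr_ge0 M.
  by split; lra.
pose p (n : nat) : {poly R} := (1 - N^-1 *: 'X) ^+ n.
have pE n x : (p n).[x] = (1 - x / N) ^+ n by rewrite /p !hornerE mulrC.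
set s := fine (Q `[0, a / 2]%classic).
have sE : Q `[0, a / 2]%classic = s%:E by rewrite fineK // fin_num_measure.
rewrite sE; congr _%:E.
have s0 : 0 <= s by rewrite fine_ge0.
pose t := 1 - a / 2 / N; pose r := 1 - a / N.
have r0 : 0 <= r by rewrite subr_ge0 ler_pdivrMr // mul1r.
have rt : r < t.
  by rewrite /r /t ltrD2l ltrN2 ltr_pM2r ?invr_gt0 //; lra.
have t0 : 0 < t := le_lt_trans r0 rt.
(* The common integral of (1 - x / N)^n is at most r^n, since [P] lives on x >= a, and at least t^n
   times the mass that [Q] gives to [0, a / 2]. As r < t, that mass is 0 in the limit. *)
have bound n : t ^+ n * s <= r ^+ n.
  have [Pi Pv] := has_moments_horner (p n) Pm.
  have [Qi Qv] := has_moments_horner (p n) Qm.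
  apply: (@le_trans _ _ (\int[P]_x (p n).[x])); last first.
    apply: (Rintegral_le_supported _ Pab Pi) => // x; rewrite /= in_itv /= => /andP[ax xb].
    rewrite pE lerXn2r ?nnegrE //.
      by rewrite subr_ge0 ler_pdivrMr // mul1r (le_trans xb).
    by rewrite lerD2l lerN2 ler_pM2r ?invr_gt0.
  rewrite Pv -Qv.
  have int_1 : Q.-integrable setT (EFin \o (\1_(`[0, a / 2]%classic) : R -> R)).
    have h := @integrable_indic _ _ R Q `[0, a / 2]%classic (measurable_itv _).
    exact: h.
  have int_ind : Q.-integrable setT (EFin \o (fun x => t ^+ n * \1_(`[0, a / 2]%classic) x)).
    by apply: eq_integrable (integrableZl _ (t ^+ n) int_1).
  have <- : \int[Q]_x (t ^+ n * \1_(`[0, a / 2]%classic) x) = t ^+ n * s.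
    rewrite RintegralZl //.
    by congr (_ * _); rewrite /Rintegral integral_indic // setIT.
  rewrite -subr_ge0 -(RintegralB measurableT Qi int_ind).
  apply: (Rintegral_ge_supported _ Q0M) => //; first by apply: eq_integrable (integrableB _ Qi int_ind).
  move=> x; rewrite /= in_itv /= => /andP[x0 xM]; rewrite pE.
  have xN : 0 <= 1 - x / N by rewrite subr_ge0 ler_pdivrMr // mul1r (le_trans xM).
  rewrite indicE; case: (boolP (x \in _)); last by rewrite mulr0 subr0 exprn_ge0.
  rewrite inE /= in_itv /= => /andP[_ xa]; rewrite mulr1 subr_ge0 lerXn2r ?nnegrE // ?(ltW t0) //.
  by rewrite lerD2l lerN2 ler_pM2r ?invr_gt0.
apply/eqP; rewrite eq_le s0 andbT.
have c0 : (r / t) ^+ n @[n --> \oo] --> 0.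
  apply: cvg_expr; rewrite ger0_norm ?divr_ge0 ?(ltW t0) //.
  by rewrite ltr_pdivrMr // mul1r.
have <- := cvg_lim (@Rhausdorff R) c0.
apply: limr_ge; [exact: cvgP c0|apply: nearW => n].
by rewrite expr_div_n ler_pdivlMr ?exprn_gt0 // mulrC.
Qed.

End MomentComparison.

Section FreePoissonRate.
Context {R : realType}.
Local Notation mu := (@lebesgue_measure R).

Lemma free_poisson_rate_gt1 (lambda alpha : R) (P Q : probability (measurableTypeR R) R)
    (m : nat -> R) (c d : R) : 0 < lambda -> 0 < alpha ->
  (forall D : set (measurableTypeR R), measurable D -> P D = free_poisson lambda alpha D) ->
  has_moments P m -> has_moments Q m -> 0 < c -> Q `[c, d]%classic = 1%E -> 1 < lambda.
Proof.
move=> lambda0 alpha0 PE Pm Qm c0 Qcd; rewrite ltNge; apply/negP => lambda1.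
set a := alpha * (1 - Num.sqrt lambda) ^+ 2.
set b := alpha * (1 + Num.sqrt lambda) ^+ 2.
have a_ge0 : 0 <= a by apply: free_poisson_itv_ge0.
have ab : a < b by apply: free_poisson_itv_lt.
have P0b : P `[0, b]%classic = 1%E.
  rewrite -(@probability_setT _ _ _ P) !PE // /free_poisson.
  rewrite !diracE !mem_setE in_itv /= lexx (le_trans a_ge0 (ltW ab)) /=.
  rewrite in_setT setTI; congr (_ + integral _ _ _)%E.
  apply/setIidr => x; rewrite /= /free_poisson_interval /= !in_itv /= => /andP[ax xb].
  by rewrite (le_trans a_ge0 (ltW ax)) ltW.
have := same_moments_null c0 Qm Pm Qcd P0b; rewrite PE // /free_poisson.
set S := `[0, c / 2]%classic; set I := (\int[_]_(_ in _) _)%E.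
have I_ge0 : (0 <= I)%E.
  apply: integral_ge0 => x [_ xab]; rewrite lee_fin.
  exact: (free_poisson_pdf_ge0 lambda0 alpha0).
have S0 : (0 : R) \in S by rewrite /S mem_setE in_itv /= lexx /=; apply: divr_ge0; rewrite ?(ltW c0).
rewrite diracE S0 mule1 => /eqP.
(* The atom and the continuous part must both vanish on [0, c / 2]. The first fact leaves only the
   rate 1, the second will exclude it. *)
rewrite padde_eq0 ?lee_fin ?le_max ?lexx // eqe => /andP[/eqP w0 /eqP I0].
have l1 : lambda = 1.
  apply/eqP; rewrite eq_le lambda1 -subr_le0 /=.
  by rewrite -[X in _ <= X]w0 le_max lexx orbT.
have a0 : a = 0 by rewrite /a l1 sqrtr1 subrr expr0n mulr0.
have bE : b = 4 * alpha by rewrite /b l1 sqrtr1; ring.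
(* At rate 1 the support starts at 0, and x (4 alpha - x) >= x^2 for x < alpha. Hence the density is
   at least 1 / (2 pi alpha) on ]0, e[. *)
pose e := Num.min (c / 2) alpha.
have e0 : 0 < e by rewrite lt_min alpha0 divr_gt0.
have sub x : x \in `]0, e[ -> [/\ 0 < x, x < c / 2 & x < alpha].
  by rewrite in_itv /= lt_min => /andP[-> /andP[-> ->]].
have : (((2 * pi * alpha)^-1 * e)%:E <= I)%E.
  have mD : measurable (S `&` free_poisson_interval lambda alpha).
    by apply: measurableI; apply: measurable_itv.
  have eD : `]0, e[ `<=` S `&` free_poisson_interval lambda alpha.
    move=> x /= /sub[x0 xc xalpha].
    rewrite /S /free_poisson_interval /= !in_itv /= -/a -/b a0 bE x0 (ltW x0) (ltW xc) /=.
    by split=> //; lra.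
  have mf : measurable_fun (S `&` free_poisson_interval lambda alpha)
      (fun x => (free_poisson_pdf lambda alpha x)%:E).
    apply: (@measurable_funS _ _ _ _ (free_poisson_interval lambda alpha)).
    - exact: measurable_itv.
    - by move=> x [].
    by apply/measurable_EFinP; apply: measurable_free_poisson_pdf.
  have le_I : (\int[mu]_(x in `]0%R, e[) (free_poisson_pdf lambda alpha x)%:E <= I)%E.
    by apply: ge0_subset_integral => // x [_ xab]; rewrite lee_fin free_poisson_pdf_ge0.
  apply: le_trans le_I.
  have -> : (((2 * pi * alpha)^-1 * e)%:E = \int[mu]_(x in `]0%R, e[) ((2 * pi * alpha)^-1)%:E)%E.
    rewrite integral_cst //= lebesgue_measure_itv /= lte_fin e0 -EFinD subr0.
    by rewrite EFinM.
  apply: ge0_le_integral => //.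
  - by move=> x _; rewrite lee_fin invr_ge0 !mulr_ge0 ?pi_ge0 // ltW.
  - exact: measurable_funS mf.
  move=> x /= xe; have [x0 xc xalpha] := sub x xe.
  have xab : x \in `]a, b[ by rewrite in_itv /= a0 x0 bE /=; lra.
  rewrite lee_fin free_poisson_pdfE // -/a -/b ler_peMr //.
    by rewrite invr_ge0 !mulr_ge0 ?pi_ge0 // ltW.
  rewrite ler_pdivlMr // mul1r /semicircle a0 bE subr0.
  rewrite -[X in X <= _](ger0_norm (ltW x0)) -sqrtr_sqr ler_wsqrtr // expr2 ler_pM2l //.
  by lra.
rewrite I0 lee_fin leNgt mulr_gt0 // invr_gt0 mulr_gt0 // mulr_gt0 // pi_gt0.
by [].
Qed.

End FreePoissonRate.

(** * Moments determined by the quadratic equations *)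

Section MomentsOfQuadraticSeries.
Context {R : realType}.
Local Notation C := (@fpsC R).
Local Notation X := (@fpsX R).

Lemma fps_sqrt_semicircle (s : fps R) (a b : R) : a < b -> fcoef s 0 = 1 ->
  s ^+ 2 = 1 - C (a + b) * X + C (a * b) * X ^+ 2 ->
  fcoef s 1 = - (a + b) / 2 /\
  forall n, fcoef s n.+2 = - (semicircle_moment a b n / pi).
Proof.
move=> ab s0 sE; have pi_neq0 : pi != 0 :> R by rewrite gt_eqF // pi_gt0.
apply: (fps_sqrt_coef s0 sE).
  by rewrite semicircle_moment0 //; move: (pi) pi_neq0 => P P0; field; rewrite ?P0.
by move=> k; rewrite mulrA semicircle_moment_rec //; ring.
Qed.

Lemma free_poisson_moments (m : nat -> R) (lambda alpha : R) :
  0 < lambda -> 0 < alpha -> m 0 = 1 -> m 1 = lambda * alpha ->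
  Fps m - 1 = X * Fps m * (C alpha * (Fps m - 1) + C (m 1)) ->
  forall n, m n.+1 = semicircle_moment (alpha * (1 - Num.sqrt lambda) ^+ 2)
    (alpha * (1 + Num.sqrt lambda) ^+ 2) n / (2 * pi * alpha).
Proof.
move=> lambda0 alpha0 m0 m1 eqm n; pose M := Fps m.
have pi_neq0 : pi != 0 :> R by rewrite gt_eqF // pi_gt0.
have alpha_neq0 : alpha != 0 by rewrite gt_eqF.
(* The square root of the discriminant of the equation, read as quadratic in [M], with the sign that
   makes the constant coefficient 1. *)
pose s := 1 + C (alpha - m 1) * X - C (2 * alpha) * (X * M).
have sE : s ^+ 2 = 1 - C (2 * alpha * (1 + lambda)) * X + C ((alpha * (1 - lambda)) ^+ 2) * X ^+ 2.
  have -> : 2 * alpha * (1 + lambda) = 2 * (alpha + m 1) by rewrite m1; ring.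
  have -> : alpha * (1 - lambda) = alpha - m 1 by rewrite m1; ring.
  rewrite -[RHS]addr0 -(mulr0 (C (4 * alpha) * X)).
  have -> : (0 : fps R) = X * M * (C alpha * (M - 1) + C (m 1)) - (M - 1).
    by rewrite -eqm subrr.
  by rewrite /s; ring.
rewrite -free_poisson_itv_sum // -free_poisson_itv_prod // in sE.
have s0 : fcoef s 0 = 1.
  by rewrite fcoefB fcoefD !fcoefCM fcoef1 !fcoefXM /=; ring.
have [_ /(_ n)] := fps_sqrt_semicircle (free_poisson_itv_lt lambda0 alpha0) s0 sE.
rewrite fcoefB fcoefD !fcoefCM fcoef1 fcoefXM /= mulr0 addr0 sub0r => /oppr_inj e.
rewrite -[m _](mulKf (x := 2 * alpha)) ?mulf_neq0 // e.
by move: (pi) pi_neq0 => P P0; field; rewrite ?P0 ?alpha_neq0.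
Qed.

Lemma free_binomial_moments (u : nat -> R) (sigma theta : R) :
  0 < sigma -> 0 < theta -> 1 < sigma + theta -> u 0 = 1 ->
  (Fps u - 1) * (Fps u - 1 + C (sigma + theta)) = X * Fps u * (Fps u - 1 + C sigma) ->
  u 1 = sigma / (sigma + theta) /\
  forall n, u n.+1 - u n.+2 = (sigma + theta) / (2 * pi) *
    semicircle_moment (fbinom_left sigma theta) (fbinom_right sigma theta) n.
Proof.
move=> sigma0 theta0 st1 u0 equ; pose L := Fps u; set lambda := sigma + theta in equ *.
have pi_neq0 : pi != 0 :> R by rewrite gt_eqF // pi_gt0.
have lambda_neq0 : lambda != 0 by rewrite gt_eqF // addr_gt0.
(* The same square root for the equation quadratic in [L - 1], divided by [lambda] to have constant
   coefficient 1. Its leading coefficient is [1 - X], which is why differences of consecutive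
   moments come out. *)
pose s := C lambda^-1 * (C lambda - C (1 + sigma) * X + 2 * (L - 1) - 2 * (X * (L - 1))).
have CV : C lambda * C lambda^-1 = 1 by rewrite -rmorphM divff // rmorph1.
have sE : s ^+ 2 = 1 - C (2 * (lambda + sigma * lambda - 2 * sigma) / lambda ^+ 2) * X +
    C (((sigma - 1) / lambda) ^+ 2) * X ^+ 2.
  transitivity (C lambda^-1 ^+ 2 * (C lambda ^+ 2 - C (2 * (lambda + sigma * lambda - 2 * sigma)) * X
      + C ((sigma - 1) ^+ 2) * X ^+ 2)); last first.
    have e1 z : C (z / lambda ^+ 2) = C lambda^-1 ^+ 2 * C z.
      by rewrite -rmorphXn -rmorphM exprVn mulrC.
    rewrite expr_div_n !e1 -[X in _ = X - _ + _](expr1n _ 2) -CV; ring.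
  rewrite -[X in _ = C _ ^+ 2 * X]addr0 -(mulr0 (4 * (1 - X))).
  have -> : (0 : fps R) = (L - 1) * (L - 1 + C lambda) - X * L * (L - 1 + C sigma).
    by rewrite equ subrr.
  by rewrite /s; ring.
rewrite -fbinom_itv_sum // -fbinom_itv_prod // in sE.
have two n (f : fps R) : fcoef (2 * f) n = 2 * fcoef f n.
  by rewrite !mulr_natl !mulr2n fcoefD.
have s0 : fcoef s 0 = 1.
  by rewrite /s fcoefCM !fcoefB fcoefD fcoefB !two !fcoefCM !fcoefXM fcoefB /= u0; field.
have [s1 s2] := fps_sqrt_semicircle (fbinom_itv_lt sigma0 theta0 st1) s0 sE.
split.
  move: s1; rewrite fbinom_itv_sum //.
  rewrite /s fcoefCM !fcoefB fcoefD fcoefB !two !fcoefCM !fcoefXM !fcoefB /= -/lambda u0 => e.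
  apply: (@mulfI _ (2 / lambda)); first by rewrite mulf_neq0 ?invr_eq0 // pnatr_eq0.
  transitivity (lambda^-1 * (0 - (1 + sigma) * 1 + 2 * (u 1%N - 0) - 2 * (1 - 1)) +
    (1 + sigma) / lambda); first by ring.
  by rewrite e; field.
move=> n; have := s2 n.
rewrite /s fcoefCM !fcoefB fcoefD fcoefB !two !fcoefCM !fcoefXM !fcoefB /= -/lambda => e.
apply: (@mulfI _ (- (2 / lambda))); first by rewrite oppr_eq0 mulf_neq0 ?invr_eq0 // pnatr_eq0.
transitivity (lambda^-1 * (0 - (1 + sigma) * 0 + 2 * (u n.+2 - 0) - 2 * (u n.+1 - 0))).
  by ring.
rewrite e; move: (semicircle_moment _ _ _) => S.
by move: (pi) pi_neq0 => P P0; field; rewrite ?P0 ?lambda_neq0.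
Qed.

End MomentsOfQuadraticSeries.

(** * Descent of the equations from complex to real coefficients *)

Section FpsMap.
Context {K L : fieldType} (f : {rmorphism K -> L}).
Implicit Types p q : fps K.

Definition fps_map p := Fps (fun n => f (fcoef p n)).

Lemma fps_mapD p q : fps_map (p + q) = fps_map p + fps_map q.
Proof. by apply: fpsP => n /=; rewrite rmorphD. Qed.
Lemma fps_mapB p q : fps_map (p - q) = fps_map p - fps_map q.
Proof. by apply: fpsP => n /=; rewrite rmorphB. Qed.
Lemma fps_mapM p q : fps_map (p * q) = fps_map p * fps_map q.
Proof.
apply: fpsP => n; rewrite fcoefM [LHS]/= rmorph_sum.
by apply: eq_bigr => i _; rewrite rmorphM.
Qed.
Lemma fps_mapC c : fps_map (fpsC c) = fpsC (f c).
Proof. by apply: fpsP => -[|n] /=; rewrite ?rmorph0. Qed.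
Lemma fps_map1 : fps_map 1 = 1.
Proof. by apply: fpsP => -[|n] /=; rewrite ?rmorph1 ?rmorph0. Qed.
Lemma fps_mapX : fps_map fpsX = fpsX.
Proof. by apply: fpsP => n /=; rewrite rmorph_nat. Qed.
Lemma fps_map_inj : injective fps_map.
Proof.
by move=> p q pq; apply: fpsP => n; apply: (fmorph_inj f); have [/(congr1 (@^~ n))] := pq.
Qed.

End FpsMap.

(** * The regression theorem *)

Section OperatorVariance.
Context {R : realType} {H : hilbertType R}.
Context (A : set 'B(H)) (phi : 'B(H) -> R[i]).
Hypothesis Aphi : wstar_probability_space A phi.

(** The variance is phi (D^2) for the self-adjoint D = X - x, and D^2 is positive. If it is 0,
    faithfulness gives D^2 = 0, hence D = 0 because the inner product of D^2 v with v is the squared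
    norm of D v. *)
Lemma self_adjoint_variance (X : 'B(H)) (x x2 : R) : A X -> self_adjoint X ->
  phi X = x%:C -> phi (X ^+ 2) = x2%:C ->
  0 <= x2 - x ^+ 2 /\ (x2 = x ^+ 2 -> X = x%:C *: (1 : 'B(H))).
Proof.
move=> AX saX phiX phiX2.
have [A_alg _ _] := wstar_vna Aphi; have [A1 AD AZ AM] := A_alg.
pose D := X - x%:C *: (1 : 'B(H)).
have AcI : A (x%:C *: (1 : 'B(H))) by apply: AZ.
have AD' : A D by have [] := wstar_sub Aphi AX AcI.
have saD : self_adjoint D.
  move=> v w.
  have -> : D v = X v - x%:C *: v by [].
  have -> : D w = X w - x%:C *: w by [].
  have Zl : hdot (x%:C *: v) w = x%:C * hdot v w by rewrite linearZl.
  have Zr : hdot v (x%:C *: w) = x%:C * hdot v w.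
    by rewrite -[in RHS](conjc_real x) linearZr.
  have Bl v1 v2 : hdot (v1 - v2) w = hdot v1 w - hdot v2 w by rewrite linearBl.
  have Br w1 w2 : hdot v (w1 - w2) = hdot v w1 - hdot v w2 by rewrite linearBr.
  by rewrite Bl Br Zl Zr saX.
have phiD2 : phi (D * D) = (x2 - x ^+ 2)%:C.
  have -> : D * D = X ^+ 2 - (x%:C *: X) - (x%:C *: D).
    rewrite {1}/D mulrBl -bop_scaleAl mul1r; congr (_ - _).
    by rewrite /D mulrBr -bop_scaleAr mulr1 expr2.
  have AX2 : A (X ^+ 2) by apply: vna_exp Aphi _ _ AX.
  have AxX : A (x%:C *: X) by apply: AZ.
  have [A1' E1] := wstar_sub Aphi AX2 AxX.
  have AxD : A (x%:C *: D) by apply: AZ.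
  rewrite (wstar_sub Aphi A1' AxD).2 E1 !(wstar_scale Aphi) // (wstar_sub Aphi AX AcI).2.
  rewrite (wstar_scale Aphi) // (wstar_one Aphi) phiX phiX2 mulr1 subrr mulr0 subr0.
  by rewrite rmorphB rmorphXn expr2.
have posD : positive_op (D * D).
  by move=> v; rewrite [(D * D) v]/(D (D v)) saD hdotxx exprn_ge0.
have AD2 : A (D * D) by apply: (AM).
split.
  by have := wstar_ge0 Aphi AD2 posD; rewrite phiD2 lecR.
move=> x2E; have : phi (D * D) = 0 by rewrite phiD2 x2E subrr.
move=> /(wstar_faithful Aphi AD2 posD) D20.
apply/eqP; rewrite -subr_eq0 -/D; apply/eqP/val_inj/funext => v /=.
apply/eqP; rewrite -normr_eq0 -sqrf_eq0 -hdotxx saD.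
by rewrite -[D (D v)]/((D * D) v) D20 -[(0 : 'B(H)) v]/(0 : H) linear0r.
Qed.

End OperatorVariance.

Section Moments.
Context {R : realType} {H : hilbertType R} (phi : 'B(H) -> R[i]).

Lemma has_distribution_moments X (P : probability (measurableTypeR R) R) :
  has_distribution phi X P ->
  exists2 m : nat -> R, has_moments P m & forall r, phi (X ^+ r.+1) = (m r)%:C.
Proof.
move=> PX; exists (fun r => \int[P]_t (t ^+ r.+1)).
  by move=> r; have [] := PX r.+1 isT.
by move=> r; have [] := PX r.+1 isT.
Qed.

Lemma has_moments_distribution X (P : probability (measurableTypeR R) R) (m : nat -> R) :
  has_moments P m -> (forall r, phi (X ^+ r.+1) = (m r)%:C) -> has_distribution phi X P.
Proof.
move=> Pm phiX [//|r] _; have [int_r Er] := Pm r; split=> //.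
by rewrite phiX Er.
Qed.

End Moments.

Section GeneratedAlgebra.
Context {R : realType} {H : hilbertType R}.
Implicit Types (A : set 'B(H)) (X Y : 'B(H)).

Lemma generated_algebra_unital X : unital_subalgebra (generated_algebra X).
Proof.
split.
- by move=> B [B1 _ _ _] _.
- by move=> S T SX TX B B_alg BX; have [_ BD _ _] := B_alg; apply: BD; [apply: SX|apply: TX].
- by move=> c T TX B B_alg BX; have [_ _ BZ _] := B_alg; apply: BZ; apply: TX.
- by move=> S T SX TX B B_alg BX; have [_ _ _ BM] := B_alg; apply: BM; [apply: SX|apply: TX].
Qed.

Lemma mem_generated_algebra X : generated_algebra X X.
Proof. by move=> B _ BX. Qed.

Lemma generated_algebra_sub A X : unital_subalgebra A -> A X -> generated_algebra X `<=` A.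
Proof. by move=> A_alg AX T; apply. Qed.

Context (A : set 'B(H)) (phi : 'B(H) -> R[i]) (Aphi : wstar_probability_space A phi).
Context (B : bool -> set 'B(H)).
Hypothesis B_alg : forall b, unital_subalgebra (B b).
Hypothesis B_sub : forall b, B b `<=` A.
Hypothesis B_free : free_subalgebras phi B.

(** The first instances of the cut identity; they serve to express c1 and c2 through the moments of
    [U] and [V]. *)
Lemma free_low_moments b X Y : B b X -> B (~~ b) Y ->
  [/\ phi (X * Y) = phi X * phi Y,
      phi (X * Y * Y) = phi X * phi (Y ^+ 2) &
      phi ((X * Y) ^+ 2) = phi X ^+ 2 * phi (Y ^+ 2) + phi (X ^+ 2) * phi Y ^+ 2 -
        phi X ^+ 2 * phi Y ^+ 2].
Proof.
move=> BX BY; have phi1 := wstar_one Aphi.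
have AX := B_sub BX; have AY := B_sub BY.
have [A_alg _ _] := wstar_vna Aphi; have [A1 AD AZ AM] := A_alg.
have [B1 _ _ _] := B_alg (~~ b).
have E1 : phi (X * Y) = phi X * phi Y.
  have := free_mixed_moments Aphi B_alg B_sub B_free 0 BX BY B1.
  by rewrite !big_ord1 /= !expr0 phi1 !mulr1 !mul1r expr1.
have E2 : phi (X * Y * Y) = phi X * phi (Y ^+ 2).
  have := free_mixed_moments Aphi B_alg B_sub B_free 0 BX BY BY.
  by rewrite !big_ord1 /= !expr0 phi1 !mulr1 !mul1r expr1.
have E2' : phi (Y * X * X) = phi Y * phi (X ^+ 2).
  have BX' : B (~~ ~~ b) X by rewrite negbK.
  have B1' : B (~~ ~~ b) 1 by have [] := B_alg (~~ ~~ b).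
  have := free_mixed_moments Aphi B_alg B_sub B_free 0 BY BX' BX'.
  by rewrite !big_ord1 /= !expr0 phi1 !mulr1 !mul1r expr1.
split=> //.
have := free_mixed_moments Aphi B_alg B_sub B_free 1 BX BY B1.
rewrite !big_ord_recl !big_ord0 /= !expr0 !expr1 phi1 !mulr1 !mul1r !addr0.
rewrite [phi (Y * (X * Y))](wstar_tracial Aphi) //; last exact: AM.
rewrite [phi (X * Y * X)](wstar_tracial Aphi) //; last exact: AM.
rewrite [X * (X * Y)]mulrA [phi (X * X * Y)](wstar_tracial Aphi) //; last exact: AM.
rewrite mulrA E2 E2' E1 => e.
by rewrite -[LHS](addrK (phi X * phi Y * (phi X * phi Y))) e; ring.
Qed.

End GeneratedAlgebra.

(** The values of c1 and c2 are stated apart from the equations because [c1 != 0] has to be deduced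
    from them before a jump size [al] can be formed. *)
Lemma free_poisson_binomial_of_regression (R : realType) (H : hilbertType R)
    (A : set 'B(H)) (phi : 'B(H) -> R[i])
    (Aphi : wstar_probability_space A phi)
    (U V : 'B(H)) (AU : A U) (AV : A V)
    (UV_free : freely_independent phi U V)
    (rV : 'B(H)) (rV_sqrt : positive_sqrt A V rV)
    (E : 'B(H) -> 'B(H)) (E_cexp : cond_exp_given A phi (rV * U * rV) E)
    (c1 c2 : R)
    (E1 : E (V - rV * U * rV) = c1%:C *: (1 : 'B(H)))
    (E2 : E ((V - rV * U * rV) ^+ 2) = c2%:C *: (1 : 'B(H)))
    (mV mU : nat -> R) (mV0 : mV 0 = 1)
    (phiV : forall r, phi (V ^+ r) = (mV r)%:C)
    (phiU : forall r, phi (U ^+ r) = (mU r)%:C)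
    (V1 : mV 1 != 0) (U1 : mU 1 != 0) :
  [/\ c1 = mV 1 * (1 - mU 1),
      c2 = mV 2 * (1 - mU 1) ^+ 2 + mV 1 ^+ 2 * (mU 2 - mU 1 ^+ 2) &
      forall al, c1 != 0 -> al * c1 = c2 - c1 ^+ 2 ->
      Fps mV - 1 = fpsX * Fps mV * (fpsC al * (Fps mV - 1) + fpsC (mV 1)) /\
      (Fps mU - 1) * (fpsC al * (Fps mU - 1) + fpsC (mV 1)) =
      fpsX * Fps mU * (fpsC al * (Fps mU - 1) + fpsC (mV 1 - c1))].
Proof.
have [A_alg _ _] := wstar_vna Aphi; have [A1 AD AZ AM] := A_alg.
have [ArV _ VE] := rV_sqrt.
pose B (b : bool) := if b then generated_algebra U else generated_algebra V.
have B_alg b : unital_subalgebra (B b) by case: b; apply: generated_algebra_unital.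
have B_sub b : B b `<=` A by case: b; apply: generated_algebra_sub.
have BU : B true U by apply: mem_generated_algebra.
have BV : B false V by apply: mem_generated_algebra.
have M1 := cexp_moment1 Aphi AU ArV VE E_cexp E1.
have M2 := cexp_moment2 Aphi AU ArV VE E_cexp E2.
have [F1 F2 F3] := free_low_moments Aphi B_alg B_sub UV_free (b := true) BU BV.
pose f : {rmorphism R -> R[i]} := real_complex R.
have phiV1 : phi V = (mV 1)%:C by rewrite -phiV expr1.
have phiU1 : phi U = (mU 1)%:C by rewrite -phiU expr1.
have mV0C : (mV 0)%:C = 1 :> R[i] by rewrite mV0 rmorph1.
have c1E : c1 = mV 1 * (1 - mU 1).
  have := M1 0; rewrite /= !expr0 !expr1 !mul1r (wstar_one Aphi) !mulr1 F1 phiV1 phiU1 => e.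
  apply: complexI; rewrite -e; rewrite !(rmorphM, rmorphB) rmorph1; ring.
have c2E : c2 = mV 2 * (1 - mU 1) ^+ 2 + mV 1 ^+ 2 * (mU 2 - mU 1 ^+ 2).
  have := M2 0; rewrite /= !expr0 !expr1 !mul1r (wstar_one Aphi) !mulr1 F2 F3 phiV phiU phiV1 phiU1 => e.
  apply: complexI; rewrite -e; rewrite !(rmorphD, rmorphM, rmorphXn, rmorphB) rmorph1 /=; ring.
pose G := mixed_fps phi U V; pose K := mixed_fps phi V U.
have GV j : G 0 * (G j - fpsC (mV j)%:C) = fpsX * (K 1 * G j.+1).
  by rewrite -phiV; apply: (mixed_fps_rec Aphi B_alg B_sub UV_free (b := true)).
have KU j : K 0 * (K j - fpsC (mU j)%:C) = fpsX * (G 1 * K j.+1).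
  by rewrite -phiU; apply: (mixed_fps_rec Aphi B_alg B_sub UV_free (b := false)).
have KG : K 0 = G 0 by exact: (mixed_fpsC Aphi AV AU).
split=> // al c1_neq0 alE.
have neq0 x : x != 0 -> x%:C != 0 :> R[i] by rewrite fmorph_eq0.
have alC : al%:C * c1%:C = c2%:C - c1%:C ^+ 2 :> R[i].
  by rewrite -rmorphM alE rmorphB rmorphXn.
have G00 : fcoef (G 0) 0 = 1 by rewrite /= !expr0 mulr1 (wstar_one Aphi).
have G10 : fcoef (G 1) 0 = (mV 1)%:C by rewrite /= expr0 mul1r phiV.
have K10 : fcoef (K 1) 0 = (mU 1)%:C by rewrite /= expr0 mul1r phiU.
have [eqV eqU] := subordination_equations GV KU KG G00 G10 K10 mV0C
  (neq0 _ V1) (neq0 _ U1) M1 M2 (neq0 _ c1_neq0) alC.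
have mapE m : Fps (fun n => (m n)%:C) = fps_map f (Fps m) by [].
split; apply: (@fps_map_inj _ _ f).
- by rewrite fps_mapB !fps_mapM fps_mapD fps_mapM fps_mapB fps_map1 !fps_mapC fps_mapX -!mapE.
- rewrite !fps_mapM fps_mapB !fps_mapD !fps_mapM fps_mapB fps_map1 !fps_mapC fps_mapX -!mapE.
  by rewrite [f (_ - _)]rmorphB; exact: eqU.
Qed.

Theorem theorem4p1 (R : realType) (H : hilbertType R)
    (A : set 'B(H)) (phi : 'B(H) -> R[i])
    (Aphi : wstar_probability_space A phi)
    (U V : 'B(H)) (AU : A U) (AV : A V)
    (saU : self_adjoint U) (saV : self_adjoint V)
    (UV_free : freely_independent phi U V)
    (V_supp : exists a b : R, 0 < a /\ distribution_supported_in phi V `[a, b])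
    (U_supp : distribution_supported_in phi U `[0, 1])
    (U_nondegenerate : forall u : R, U <> u%:C *: (1 : 'B(H)))
    (rV : 'B(H)) (rV_sqrt : positive_sqrt A V rV)
    (E : 'B(H) -> 'B(H)) (E_cexp : cond_exp_given A phi (rV * U * rV) E)
    (c1 c2 : R)
    (E1 : E (V - rV * U * rV) = c1%:C *: (1 : 'B(H)))
    (E2 : E ((V - rV * U * rV) ^+ 2) = c2%:C *: (1 : 'B(H))) :
  let theta := c1 ^+ 2 / (c2 - c1 ^+ 2) in
  let alpha := (c2 - c1 ^+ 2) / c1 in
  exists sigma : R,
    [/\ 0 < sigma, 0 < theta, 1 < sigma + theta & 0 < alpha] /\
    has_law phi V (free_poisson (sigma + theta) alpha) /\
    has_law phi U (free_binomial sigma theta).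
Proof.
move=> theta alpha.
have [a [b [a0 [PV VP PVab]]]] := V_supp.
have [PU UP PU01] := U_supp.
have [v PVv phiV] := has_distribution_moments VP.
have [u PUu phiU] := has_distribution_moments UP.
pose mV n := if n is k.+1 then v k else 1; pose mU n := if n is k.+1 then u k else 1.
have phi_pow (X : 'B(H)) (x : nat -> R) : (forall r, phi (X ^+ r.+1) = (x r)%:C) ->
    forall r, phi (X ^+ r) = (if r is k.+1 then x k else 1)%:C.
  by move=> phiX [|r //]; rewrite expr0 (wstar_one Aphi) rmorph1.
have phiV' := phi_pow _ _ phiV; have phiU' := phi_pow _ _ phiU.
have v0 : 0 < v 0.
  apply: lt_le_trans a0 _; rewrite -(PVv 0).2.
  by apply: (Rintegral_ge_supported _ PVab (PVv 0).1) => // x; rewrite /= in_itv /= => /andP[].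
have [varV _] := self_adjoint_variance Aphi AV saV (phiV 0) (phiV 1).
have [varU0 varU_eq] := self_adjoint_variance Aphi AU saU (phiU 0) (phiU 1).
have varU : 0 < u 1 - u 0 ^+ 2.
  rewrite lt_def varU0 andbT subr_eq0; apply/eqP => /varU_eq.
  exact: U_nondegenerate.
have u1_le : u 1 <= u 0.
  rewrite -subr_le0 -(PUu 0).2 -(PUu 1).2 -(RintegralB measurableT (PUu 1).1 (PUu 0).1).
  apply: (Rintegral_le_supported _ PU01) => //.
    by apply: eq_integrable (integrableB _ (PUu 1).1 (PUu 0).1).
  move=> x; rewrite /= in_itv /= => /andP[x0 x1].
  by rewrite expr1 subr_le0 expr2 ler_piMl.
(* On [0, 1] one has x^2 <= x, so u_0 (1 - u_0) >= u_1 - u_0^2, which is positive because [U] is not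
   a scalar. *)
have [u0_gt0 u0_lt1] : 0 < u 0 /\ u 0 < 1.
  have u00 : 0 < u 0 * (1 - u 0) by rewrite mulrBr mulr1 -expr2; lra.
  have u0_ge0 : 0 <= u 0.
    rewrite -(PUu 0).2; apply: (Rintegral_ge_supported _ PU01 (PUu 0).1) => // x.
    by rewrite /= in_itv /= => /andP[].
  have u0_gt0 : 0 < u 0 by rewrite lt_def u0_ge0 andbT; apply: contraTneq u00 => ->; rewrite mul0r ltxx.
  by split=> //; move: u00; rewrite pmulr_rgt0 // subr_gt0.
have v_neq0 : mV 1 != 0 by rewrite gt_eqF.
have u_neq0 : mU 1 != 0 by rewrite gt_eqF.
have [c1E c2E moments] := free_poisson_binomial_of_regression Aphi AU AV UV_free rV_sqrt
  E_cexp E1 E2 (mV := mV) (mU := mU) erefl phiV' phiU' v_neq0 u_neq0.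
have c1_gt0 : 0 < c1 by rewrite c1E mulr_gt0 // subr_gt0.
have c1_neq0 : c1 != 0 by rewrite gt_eqF.
(* By freeness c_2 - c_1^2 = Var (V) (1 - phi (U))^2 + phi (V)^2 Var (U); the second term is
   positive even if the variance of [V] vanishes. *)
have delta_gt0 : 0 < c2 - c1 ^+ 2.
  have -> : c2 - c1 ^+ 2 = (v 1 - v 0 ^+ 2) * (1 - u 0) ^+ 2 + v 0 ^+ 2 * (u 1 - u 0 ^+ 2).
    by rewrite c2E c1E /mV /mU /=; ring.
  apply: ltr_wpDl; first by rewrite mulr_ge0 ?sqr_ge0.
  by rewrite mulr_gt0 // exprn_gt0.
have alpha_gt0 : 0 < alpha by rewrite divr_gt0.
have alpha_neq0 : alpha != 0 by rewrite gt_eqF.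
have theta_gt0 : 0 < theta by rewrite divr_gt0 // exprn_gt0.
have alphaE : alpha * c1 = c2 - c1 ^+ 2 by rewrite divfK.
(* The numerator is phi (V) phi (U), the mean of [rV * U * rV]. Since alpha theta = c_1, the rate
   sigma + theta has alpha (sigma + theta) = phi (V), as the mean of a free Poisson law requires. *)
pose sigma := (v 0 - c1) / alpha.
have sigma_gt0 : 0 < sigma.
  have -> : sigma = v 0 * u 0 / alpha by rewrite /sigma c1E /mV /mU /=; congr (_ / _); ring.
  by rewrite divr_gt0 // mulr_gt0.
pose lambda := sigma + theta.
have lambdaE : lambda * alpha = v 0.
  rewrite /lambda mulrDl divfK // /theta -alphaE.
  by field; rewrite alpha_neq0 c1_neq0.
have lambda_gt0 : 0 < lambda by rewrite addr_gt0.
have [eqV eqU] := moments alpha c1_neq0 alphaE.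
have vE := free_poisson_moments lambda_gt0 alpha_gt0 erefl (esym lambdaE) eqV.
have [P PE Pm] := free_poisson_law lambda_gt0 alpha_gt0.
have Pv : has_moments P v by move=> r; rewrite -[v r]/(mV r.+1) vE; apply: Pm.
(* [PV] and the free Poisson law share all moments, and [PV] lives away from 0. The resulting bound
   is exactly the admissibility condition of the free binomial parameters. *)
have lambda_gt1 := free_poisson_rate_gt1 lambda_gt0 alpha_gt0 PE Pv PVv a0 PVab.
(* With m_1 = alpha (sigma + theta) and m_1 - c_1 = alpha sigma, every term contains the factor
   alpha, which is cancelled. *)
have {}eqU : (Fps mU - 1) * (Fps mU - 1 + fpsC (sigma + theta)) =
    fpsX * Fps mU * (Fps mU - 1 + fpsC sigma).
  apply/eqP; rewrite -subr_eq0; apply/eqP.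
  apply: (@fps_unit_reg _ (fpsC alpha)); first by rewrite fcoefC.
  have sigmaE : mV 1 - c1 = alpha * sigma by rewrite mulrC divfK.
  have : mV 1 = alpha * (sigma + theta) by rewrite mulrC lambdaE.
  move: eqU; rewrite sigmaE => eqU lE.
  move: eqU; rewrite lE !rmorphM => /eqP; rewrite -subr_eq0 => /eqP eqU.
  by rewrite -[RHS]eqU; ring.
have [uE u_rec] := free_binomial_moments sigma_gt0 theta_gt0 lambda_gt1 erefl eqU.
have [Q QE Qm] := free_binomial_law sigma_gt0 theta_gt0 lambda_gt1.
exists sigma; split; first by split.
split; first by exists P => //; apply: has_moments_distribution Pv phiV.
by exists Q => //; apply: has_moments_distribution (Qm u uE u_rec) phiU.
Qed.
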